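(* Let $d\ge1$ be an integer, $h\in(0,1]$, $C>0$, $M>0$, assume $P\in\mathcal{D}^{(h,C,M)}$, and consider, for $n\ge1$, the $k$-nearest neighbor model $$\hat F_{n,x}(z)=\frac{1}{k_n}\sum_{i=1}^{k_n}\mathbf{1}_{Y_{i:n}(x)\le z}.$$ (a) For $d=1$, the choice $k_n=\left(\dfrac{M}{hC^28^h}\right)^{\frac1{h+1}}n^{\frac h{h+1}}$ (assumed to be an integer with $1\le k_n\le n$) yields $$\mathbb{E}_{D_n\sim P^n}[R_P(\hat F_n)]-R_P(F^\ast)\le B\,n^{-\frac h{h+1}}$$ with $B=C^{\frac2{h+1}}M^{\frac h{h+1}}8^{\frac h{h+1}}\left(h^{-\frac h{h+1}}+h^{\frac1{h+1}}\right)$. (b) For $d\ge2$, the choice $k_n=\left(\dfrac{Md}{2hC^2c_d^h}\right)^{\frac d{2h+d}}n^{\frac{2h}{2h+d}}$ (assumed to be an integer with $1\le k_n\le n$) yields $$\mathbb{E}_{D_n\sim P^n}[R_P(\hat F_n)]-R_P(F^\ast)\le B\,n^{-\frac{2h}{2h+d}}$$ with $B=(C^2c_d^h)^{\frac d{2h+d}}M^{\frac{2h}{2h+d}}\left(\left(\frac d{2h}\right)^{\frac{2h}{2h+d}}+\left(\frac{2h}d\right)^{\frac d{2h+d}}\right)$. Here $c_d=\dfrac{2^{3+\frac2d}(1+\sqrt d)^2}{V_d^{2/d}}$ and $V_d$ is the volume of the unit ball in $\mathbb{R}^d$.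
   Context: Setting: $(X,Y)\in\mathbb{R}^d\times\mathbb{R}$ is a random pair with distribution $P$, $P_X$ is the marginal law of $X$, and $F^\ast_x(y)=P(Y\le y\mid X=x)$ is the conditional distribution function of $Y$ given $X=x$ (a version of it). The training sample is $D_n=\{(X_i,Y_i),1\le i\le n\}\sim P^n$ (i.i.d. with law $P$), independent of the test pair $(X,Y)\sim P$. For a distribution function $F$ and $y\in\mathbb{R}$, $\mathrm{CRPS}(F,y)=\int_{\mathbb{R}}(F(z)-\mathbf{1}_{y\le z})^2\,dz$. The risk of a predictor $\hat F:x\mapsto\hat F_x$ is $R_P(\hat F)=\mathbb{E}_{(X,Y)\sim P}[\mathrm{CRPS}(\hat F_X,Y)]$. When $Y$ is integrable, the excess risk satisfies $\mathbb{E}_{D_n\sim P^n}[R_P(\hat F_n)]-R_P(F^\ast)=\mathbb{E}_{D_n\sim P^n,X\sim P_X}\left[\int_{\mathbb{R}}|\hat F_{n,X}(z)-F^\ast_X(z)|^2\,dz\right]$. The $k$-NN model is defined for integers $1\le k_n\le n$; $Y_{i:n}(x)$ denotes the response associated with the $i$-th nearest neighbor of $x$ among $X_1,\dots,X_n$ (Euclidean distance, ties broken at random). For $h\in(0,1]$, $C>0$, $M>0$, $\mathcal{D}^{(h,C,M)}$ is the class of distributions $P$ of $(X,Y)$ such that: i) $X\in[0,1]^d$ $P_X$-a.s.; ii) for all $x\in[0,1]^d$, $\int_{\mathbb{R}}F^\ast_x(z)(1-F^\ast_x(z))\,dz\le M$; iii) $\|F^\ast_{x'}-F^\ast_x\|_{L^2}\le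 C\|x'-x\|^h$ for all $x,x'\in[0,1]^d$, where $\|\cdot\|_{L^2}$ is the norm of $L^2(\mathbb{R})$ (Lebesgue measure) and $\|\cdot\|$ is the Euclidean norm. *)

(* Defs.v *)
From HB Require Import structures.
From mathcomp Require Import all_boot all_order all_algebra perm.
From mathcomp Require Import all_classical all_reals all_analysis.
Set Implicit Arguments.
Unset Strict Implicit.
Unset Printing Implicit Defensive.
Import Order.TTheory GRing.Theory Num.Theory.
Import numFieldNormedType.Exports.
Local Open Scope classical_set_scope.
Local Open Scope ring_scope.

(* Powers of measures: [n.-tuple T] carries the product sigma-algebra, but the
   library has no product measure on it. *)

Section tuple_cons.
Context {dT : measure_display} {T : measurableType dT}.

Definition tcons n (u : T * n.-tuple T) : n.+1.-tuple T :=
  [tuple of u.1 :: u.2].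

Definition tuncons n (t : n.+1.-tuple T) : T * n.-tuple T :=
  (thead t, [tuple of behead t]).

Lemma tconsK n : cancel (@tcons n) (@tuncons n).
Proof.
by case=> x t; rewrite /tuncons /tcons theadE; congr (_, _); exact/val_inj.
Qed.

Lemma measurable_tnth n (i : 'I_n) :
  measurable_fun [set: n.-tuple T] (fun t => tnth t i).
Proof.
case: n i => [[]//|n] i _ B mB; rewrite setTI; apply: sub_sigma_algebra.
rewrite -bigcup_mkord_ord; exists i; first by case: i.
by exists B; rewrite // setTI inord_val.
Qed.

Lemma measurable_fun_tnthP d' (U : measurableType d') n (f : U -> n.-tuple T) :
  (forall i, measurable_fun [set: U] (fun u => tnth (f u) i)) ->
  measurable_fun [set: U] f.
Proof.
move=> mf; apply: (@measurability _ _ _ _ _ _ (\big[setU/set0]_(i < n)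
  preimage_set_system setT (fun t : n.-tuple T => tnth t i) measurable)) => //.
case: n f mf => [|n] f mf _ [B + <-]; first by rewrite big_ord0.
rewrite -bigcup_mkord_ord => -[i Ii [A mA <-]].
by rewrite [X in f @^-1` X]setTI; exact: (mf (inord i) measurableT A mA).
Qed.

Lemma measurable_tcons n : measurable_fun [set: T * n.-tuple T] (@tcons n).
Proof.
apply: measurable_fun_tnthP => i; case: (unliftP ord0 i) => [j|] ->.
  have -> : (fun u => tnth (@tcons n u) (lift ord0 j)) =
      (fun t => tnth t j) \o snd by apply/funext => u; exact: tnthS.
  exact: measurableT_comp (measurable_tnth j) measurable_snd.
have -> : (fun u => tnth (@tcons n u) ord0) = fst by apply/funext => u.
exact: measurable_fst.
Qed.

HB.instance Definition _ n :=
  isMeasurableFun.Build _ _ _ _ (@tcons n) (@measurable_tcons n).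

Lemma measurable_tuncons n : measurable_fun [set: n.+1.-tuple T] (@tuncons n).
Proof.
apply/measurable_fun_pairP; split; first exact: (measurable_tnth ord0).
apply: measurable_fun_tnthP => i.
rewrite (_ : (fun _ => _) = fun t : n.+1.-tuple T => tnth t (lift ord0 i)).
  exact: measurable_tnth.
by apply/funext => t; rewrite [in RHS](tuple_eta t) tnthS.
Qed.

End tuple_cons.

Section tcons_measure.
Context {dT : measure_display} {T : measurableType dT} {R : realType}.
Variables (n : nat) (m : {sigma_finite_measure set T -> \bar R}).
Variable p : {sigma_finite_measure set (n.-tuple T) -> \bar R}.
Local Open Scope ereal_scope.

Definition tcons_measure := pushforward (m \x p) (@tcons _ T n).

Let mtcons A : measurable A -> measurable (@tcons _ T n @^-1` A).
Proof. by move=> mA; rewrite -[X in measurable X]setTI; exact: measurable_tcons. Qed.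

Let tcons_measure0 : tcons_measure set0 = 0.
Proof. by rewrite /tcons_measure /pushforward preimage_set0 measure0. Qed.

Let tcons_measure_ge0 A : 0 <= tcons_measure A.
Proof. exact: measure_ge0. Qed.

Let tcons_measure_sigma_additive : semi_sigma_additive tcons_measure.
Proof.
move=> F mF tF mUF; rewrite /tcons_measure /pushforward preimage_bigcup.
apply: measure_semi_sigma_additive.
- by move=> k; exact: mtcons.
- apply/trivIsetP => /= i j _ _ ij; rewrite -preimage_setI.
  by move/trivIsetP : tF => /(_ _ _ _ _ ij) ->//; rewrite preimage_set0.
- by rewrite -preimage_bigcup; exact: mtcons.
Qed.

HB.instance Definition _ := isMeasure.Build _ _ _ tcons_measure
  tcons_measure0 tcons_measure_ge0 tcons_measure_sigma_additive.

Let tcons_measure_sigma_finite : sigma_finite setT tcons_measure.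
Proof.
have /sigma_finiteP[F [TF ndF Foo]] := sigma_finiteT m.
have /sigma_finiteP[G [TG ndG Goo]] := sigma_finiteT p.
exists (fun i => @tuncons _ T n @^-1` (F i `*` G i)).
  rewrite -preimage_bigcup [X in _ @^-1` X](_ : _ = setT) ?preimage_setT//.
  rewrite -subTset => -[x t] _.
  have [i _ Fix] : (\bigcup_i F i) x by rewrite -TF.
  have [j _ Gjt] : (\bigcup_j G j) t by rewrite -TG.
  exists (maxn i j) => //; split => /=.
    by move: Fix; exact/subsetPset/ndF/leq_maxl.
  by move: Gjt; exact/subsetPset/ndG/leq_maxr.
move=> i; have [mFi Fioo] := Foo i; have [mGi Gioo] := Goo i.
have mFG : measurable (F i `*` G i) by exact: measurableX.
split; first by rewrite -[X in measurable X]setTI; exact: measurable_tuncons.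
rewrite /tcons_measure /pushforward.
rewrite (_ : _ @^-1` _ = F i `*` G i).
  by rewrite product_measure1E// lte_mul_pinfty// ge0_fin_numE.
by rewrite -comp_preimage (_ : _ \o _ = id) //; apply/funext => u; exact: tconsK.
Qed.

HB.instance Definition _ := @Measure_isSigmaFinite.Build _ _ _
  tcons_measure tcons_measure_sigma_finite.

End tcons_measure.

Section tuple_power.
Context {dT : measure_display} {T : measurableType dT} {R : realType}.
Local Open Scope ereal_scope.

Fixpoint tuple_power (m : {sigma_finite_measure set T -> \bar R}) (n : nat) :
    {sigma_finite_measure set (n.-tuple T) -> \bar R} :=
  match n with
  | 0 => dirac [tuple]
  | n'.+1 => tcons_measure m (tuple_power m n')
  end.

Lemma tuple_power_box (m : {sigma_finite_measure set T -> \bar R}) n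
    (A : 'I_n -> set T) : (forall i, measurable (A i)) ->
  tuple_power m n [set t | forall i, A i (tnth t i)] = \prod_(i < n) m (A i).
Proof.
elim: n A => [|n IH] A mA.
  rewrite big_ord0 /= diracE mem_set//=; by case.
have mbox k (B : 'I_k -> set T) : (forall i, measurable (B i)) ->
    measurable [set t : k.-tuple T | forall i, B i (tnth t i)].
  move=> mB; rewrite (_ : mkset _ = \bigcap_(i in [set: 'I_k])
      ((fun t : k.-tuple T => tnth t i) @^-1` B i)).
    apply: fin_bigcap_measurable => // i _.
    by rewrite -[X in measurable X]setTI; exact: measurable_tnth.
  by apply/seteqP; split=> t Bt i; [move=> _; exact: Bt|exact: (Bt i I)].
rewrite big_ord_recl -(IH (fun i => A (lift ord0 i)))//=.
rewrite /tcons_measure /pushforward.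
rewrite (_ : _ @^-1` _ = A ord0 `*`
    [set t | forall i, A (lift ord0 i) (tnth t i)]).
  rewrite product_measure1E//.
  by apply: (mbox n (fun i => A (lift ord0 i))) => i; exact: mA.
apply/seteqP; split=> -[x t] /=.
  move=> At; split; first exact: (At ord0).
  by move=> i; have := At (lift ord0 i); rewrite tnthS.
by move=> [A0 At] i; case: (unliftP ord0 i) => [j|] -> //; rewrite tnthS.
Qed.

End tuple_power.

Section model.
Context {R : realType} {d : nat}.

Definition eucl_norm (v : 'I_d -> R) : R := Num.sqrt (\sum_(i < d) v i ^+ 2).

Definition eucl_dist (x x' : d.-tuple R) : R :=
  eucl_norm (fun i => tnth x i - tnth x' i).

Definition unit_cube : set (d.-tuple R) :=
  [set x | forall i, 0 <= tnth x i <= 1].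

Definition indicator_le (y z : R) : R := (y <= z)%R%:R.

Definition CRPS (F : R -> R) (y : R) : \bar R :=
  (\int[lebesgue_measure]_z ((F z - indicator_le y z) ^+ 2)%:E)%E.

(* The risk is [\bar R]-valued; it is the integral of a nonnegative function,
   hence meaningful without any integrability assumption. *)
Definition risk (P : probability (d.-tuple R * R)%type R)
    (F : d.-tuple R -> R -> R) : \bar R :=
  (\int[P]_u CRPS (F u.1) u.2)%E.

(* [K x B] is a version of P(Y \in B | X = x). *)
Definition is_cond_distr (P : probability (d.-tuple R * R)%type R)
    (K : R.-pker (d.-tuple R) ~> R) : Prop :=
  forall (A : set (d.-tuple R)) (B : set R), measurable A -> measurable B ->
    P (A `*` B) = (\int[pushforward P fst]_(x in A) K x B)%E.

Definition cond_cdf (K : R.-pker (d.-tuple R) ~> R) (x : d.-tuple R) (y : R) :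
  R := fine (K x `]-oo, y]%classic).

(* The conditional distribution function is only determined up to a P_X-null
   set of x, so the conditions below, which are required at every point of the
   cube, are conditions on some version of it. *)
Definition holder_class (h C M : R) (P : probability (d.-tuple R * R)%type R) :
    Prop :=
  exists2 K : R.-pker (d.-tuple R) ~> R, is_cond_distr P K &
  [/\ {ae P, forall u, unit_cube u.1},
      forall x, unit_cube x ->
        (\int[lebesgue_measure]_z
           (cond_cdf K x z * (1 - cond_cdf K x z))%:E <= M%:E)%E &
      forall x x', unit_cube x -> unit_cube x' ->
        (Lnorm lebesgue_measure 2%:E
           (fun z => (cond_cdf K x' z - cond_cdf K x z)%:E)
         <= (C * eucl_dist x' x `^ h)%:E)%E].

(* Random tie-breaking: [s] is a uniformly random ranking of the indices,
   independent of the data, and points at equal distance are ordered by rank. *)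
Definition nn_le n (D : n.-tuple (d.-tuple R * R)) (s : 'S_n) (x : d.-tuple R)
    : rel 'I_n := fun i j =>
  let di := eucl_dist (tnth D i).1 x in
  let dj := eucl_dist (tnth D j).1 x in
  (di < dj) || (di == dj) && (s i <= s j)%N.

(* Responses from the nearest to the farthest neighbour of [x]; as sequences
   are numbered from 0, the (i+1)-st nearest neighbour has index i. *)
Definition nn_responses n (D : n.-tuple (d.-tuple R * R)) (s : 'S_n)
    (x : d.-tuple R) : seq R :=
  [seq (tnth D i).2 | i <- sort (nn_le D s x) (enum 'I_n)].

Definition knn n (k : nat) (D : n.-tuple (d.-tuple R * R)) (s : 'S_n)
    (x : d.-tuple R) (z : R) : R :=
  k%:R^-1 * \sum_(i < k) indicator_le (nth 0 (nn_responses D s x) i) z.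

(* Expectation over the sample and over the tie-breaking permutation. *)
Definition knn_expected_risk (P : probability (d.-tuple R * R)%type R)
    (n k : nat) : \bar R :=
  ((n`!%:R^-1)%:E * \sum_(s : 'S_n)
     \int[tuple_power P n]_D risk P (knn k D s))%E.

End model.

Section constants.
Context {R : realType}.

Definition unit_ball_volume (d : nat) : R :=
  fine (tuple_power (@lebesgue_measure R) d
          [set x : d.-tuple R | eucl_norm (tnth x) <= 1]).

Definition c_ (d : nat) : R :=
  2 `^ (3 + 2 / d%:R) * (1 + Num.sqrt d%:R) ^+ 2
    / unit_ball_volume d `^ (2 / d%:R).

End constants.

(* Main.v *)
(** The excess risk of a predictor is the integrated squared error of its
conditional distribution functions, because [(f - 1{y <= z}) ^ 2] equals
[(f - F) ^ 2 + F (1 - F)] plus a term which is linear in [1{y <= z} - F] and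
hence has mean zero.  Writing the k-NN predictor as the average of the
responses of nonzero weight, with weights that only depend on the covariates,
the same orthogonality splits its mean squared error into a variance term, at
most [M / k] after integration in [z], and a squared bias, at most [C ^ 2]
times the mean of [r ^ (2 h)], where [r] is the distance from [X] to its k-th
neighbour.

The moments of [r] come from a packing argument applied to the n + 1
exchangeable points formed by the sample and [X].  If [r i] is the k-NN distance
of the i-th point to the others, a point of space lies in at most [k] of the
balls of radius [r i / sqrt 8] (compare with the ball of largest radius), and
all these balls lie in a cube of side [1 + sqrt d].  Comparing volumes bounds
the sum of the [r i ^ d] by a multiple of [k], and by exchangeability
the mean of [r ^ d] is at most 1 / (n + 1) times this bound.  Concavity of
[t ^ (2 h / d)] then yields the rate, and [k] balances the two terms. *)

Require Import Defs.
From HB Require Import structures.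
From mathcomp Require Import all_boot all_order all_algebra perm.
From mathcomp Require Import all_classical all_reals all_analysis.
From mathcomp Require Import measurable_realfun lra ring.
Set Implicit Arguments.
Unset Strict Implicit.
Unset Printing Implicit Defensive.
Import Order.TTheory GRing.Theory Num.Theory.
Import numFieldNormedType.Exports.
Local Open Scope classical_set_scope.
Local Open Scope ring_scope.

(** * Powers of measures *)

(** Risks are extended real integrals, so the excess risk cannot be manipulated as a difference of
    integrals. The orthogonality relations are proved at a fixed level [z], where indicators and
    distribution functions lie in [0, 1]; Tonelli's theorem then restores the integral in [z], and
    the risk is decomposed as a sum. Conditioning on the covariates is replaced by integrating one
    entry of the tuple at a time against the kernel.

    The factor sqrt 8 fits the inequality |x - y|^2 <= 2 |x - p|^2 + 2 |p - y|^2: if the balls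
    around x and y share p and the larger k-NN distance is r, the centres are at squared distance at
    most r^2 / 2. They are thus strictly closer than r, and at most [k] points, the centre included,
    are strictly closer than a k-NN distance.

    Concavity of t ^ (2 h / d) requires 2 h <= d, which holds when d >= 2 but may fail when d = 1.
    In that case r <= 1 gives r ^ (2 h) <= r ^ h, and concavity is applied to t ^ h; this is where
    the slower rate in dimension one comes from. *)

Section tuple_power_theory.
Context {dT : measure_display} {T : measurableType dT} {R : realType}.
Local Open Scope ereal_scope.

Definition tuple_box n (A : 'I_n -> set T) : set (n.-tuple T) :=
  [set t | forall i, A i (tnth t i)].

Lemma measurable_tuple_box n (A : 'I_n -> set T) :
  (forall i, measurable (A i)) -> measurable (tuple_box A).
Proof.
move=> mA; rewrite (_ : tuple_box A = \bigcap_(i in [set: 'I_n])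
    ((fun t : n.-tuple T => tnth t i) @^-1` A i)).
  apply: fin_bigcap_measurable => // i _.
  by rewrite -[X in measurable X]setTI; exact: Defs.measurable_tnth.
by apply/seteqP; split=> t At i; [move=> _; exact: At|exact: (At i I)].
Qed.

Variable m : {sigma_finite_measure set T -> \bar R}.

Lemma ge0_integral_tuple_powerS n (f : n.+1.-tuple T -> \bar R) :
  measurable_fun [set: n.+1.-tuple T] f -> (forall t, 0 <= f t) ->
  \int[tuple_power m n.+1]_t f t =
  \int[m]_u \int[tuple_power m n]_t f (tcons (u, t)).
Proof.
move=> mf f0.
transitivity (\int[m \x tuple_power m n]_u (f \o @tcons _ T n) u); last first.
  rewrite (fubini_tonelli1 (f \o @tcons _ T n))//; last by move=> u; exact: f0.
  exact: measurableT_comp mf (@measurable_tcons _ T n).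
have := @ge0_integral_pushforward _ _ _ _ R _ (@measurable_tcons _ T n)
  (m \x tuple_power m n)%E _ f measurableT mf (fun t _ => f0 t).
by rewrite preimage_setT.
Qed.

Lemma ge0_integral_tuple_powerSr n (f : n.+1.-tuple T -> \bar R) :
  measurable_fun [set: n.+1.-tuple T] f -> (forall t, 0 <= f t) ->
  \int[tuple_power m n.+1]_t f t =
  \int[tuple_power m n]_t \int[m]_u f (tcons (u, t)).
Proof.
move=> mf f0; rewrite ge0_integral_tuple_powerS//.
rewrite (fubini_tonelli (f \o @tcons _ T n))//; last by move=> u; exact: f0.
exact: measurableT_comp mf (@measurable_tcons _ T n).
Qed.

(** Boxes form a pi-system generating the product sigma-algebra, and [F] exhausts the space by boxes
    of finite measure. With [F] constant this serves permutations of a sample, with growing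
    intervals it serves Lebesgue measure. *)
Lemma tuple_power_unique n (mu : {measure set (n.-tuple T) -> \bar R})
    (F : (set T)^nat) :
  (forall j, measurable (F j)) -> (forall j, m (F j) < +oo) ->
  nondecreasing_seq F -> \bigcup_j F j = setT ->
  (forall A : 'I_n -> set T, (forall i, measurable (A i)) ->
     mu (tuple_box A) = \prod_(i < n) m (A i)) ->
  forall A, measurable A -> tuple_power m n A = mu A.
Proof.
move=> mF Foo ndF UF muE.
pose G := [set tuple_box A | A in [set A : 'I_n -> set T |
  forall i, measurable (A i)]].
apply: (@measure_unique _ _ _ G (fun j => tuple_box (fun _ => F j))).
- apply/seteqP; split.
    apply: smallest_sub; first exact: smallest_sigma_algebra.
    case: {mu muE} n @G => [|n] G; first by rewrite big_ord0.
    rewrite -bigcup_mkord_ord => _ [i Ii [A mA <-]].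
    apply: sub_sigma_algebra.
    exists (fun j => if j == inord i then A else setT).
      by move=> j /=; case: ifPn.
    apply/seteqP; split => [t /(_ (inord i)) | t [_ At] j] /=.
      by rewrite eqxx.
    by case: eqVneq => // ->.
  apply: smallest_sub; first exact: sigma_algebra_measurable.
  by move=> _ [A mA <-]; exact: measurable_tuple_box.
- move=> _ _ [A mA <-] [B mB <-]; exists (fun i => A i `&` B i).
    by move=> i; exact: measurableI.
  apply/seteqP; split => [t AB|t [At Bt] i]; last by split.
  by split=> i; case: (AB i).
- by move=> j; exists (fun _ => F j).
- rewrite -subTset => t _.
  have Ft i : exists j, F j (tnth t i).
    have : (\bigcup_j F j) (tnth t i) by rewrite UF.
    by move=> [j _ Fj]; exists j.
  have [g Fg] := choice Ft.
  (* Finitely many coordinates, so one index of the nondecreasing sequence works for all of them. *)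
  exists (\max_(i < n) g i)%N => //= i.
  have : (F (g i) <= F (\max_(i < n) g i)%N)%O by exact/ndF/leq_bigmax.
  by move/subsetPset; apply; exact: Fg.
- by move=> _ [A mA <-]; rewrite muE//; exact: tuple_power_box.
- move=> j; rewrite [X in X < _](tuple_power_box _ (fun _ => mF j)).
  have : m (F j) \is a fin_num by rewrite ge0_fin_numE.
  by move=> /fineK <-; rewrite prodEFin ltry.
Qed.

End tuple_power_theory.

Section tuple_power_probability.
Context {dT : measure_display} {T : measurableType dT} {R : realType}.
Variable P : probability T R.
Local Open Scope ereal_scope.

Lemma tuple_power_setT n : tuple_power P n setT = 1.
Proof.
rewrite (_ : setT = tuple_box (fun _ : 'I_n => [set: T])).
  rewrite [LHS](tuple_power_box P (fun _ : 'I_n => measurableT)) big1// => i _.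
  exact: probability_setT.
by apply/seteqP; split.
Qed.

Definition tuple_perm n (s : 'S_n) (t : n.-tuple T) : n.-tuple T :=
  [tuple tnth t (s i) | i < n].

Lemma measurable_tuple_perm n (s : 'S_n) :
  measurable_fun [set: n.-tuple T] (tuple_perm s).
Proof.
apply: Defs.measurable_fun_tnthP => i.
rewrite (_ : (fun _ => _) = (fun t : n.-tuple T => tnth t (s i))).
  exact: Defs.measurable_tnth.
by apply/funext => t; rewrite tnth_mktuple.
Qed.

(** Exchangeability of an i.i.d. sample: the preimage of a box under a permutation of the entries is
    the box with permuted sides, and the product of the measures of the sides is unchanged. *)
Lemma ge0_integral_tuple_perm n (s : 'S_n) (f : n.-tuple T -> \bar R) :
  measurable_fun [set: n.-tuple T] f -> (forall t, 0 <= f t) ->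
  \int[tuple_power P n]_t f (tuple_perm s t) = \int[tuple_power P n]_t f t.
Proof.
move=> mf f0.
have := @ge0_integral_pushforward _ _ _ _ R _ (measurable_tuple_perm s)
  (tuple_power P n) _ f measurableT mf (fun t _ => f0 t).
rewrite preimage_setT => <-.
apply: eq_measure_integral => [|mp A mA _]; first exact: measurable_tuple_perm.
symmetry.
apply: (@tuple_power_unique _ _ _ P n _ (fun _ => setT)) => //.
- by move=> _; apply: (le_lt_trans (probability_le1 P measurableT)); exact: ltry.
- by rewrite bigcup_const//; exists 0%N.
move=> B mB; transitivity (tuple_power P n (tuple_perm s @^-1` tuple_box B)) => //.
rewrite (_ : _ @^-1` _ = tuple_box (fun i => B (s^-1 i)%g)).
  rewrite [LHS](tuple_power_box P (fun i => mB _)).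
  rewrite (reindex_inj (@perm_inj _ s))/=.
  by apply: eq_bigr => i _; rewrite permK.
apply/seteqP; split => [t Bt i|t Bt i] /=.
  by have := Bt (s^-1 i)%g; rewrite tnth_mktuple permKV.
by rewrite tnth_mktuple; have := Bt (s i); rewrite permK.
Qed.

End tuple_power_probability.

Section lebesgue_ball.
Context {R : realType}.
Local Notation mu := (@lebesgue_measure R).
Local Open Scope ereal_scope.

(** The right-hand side is a measure in [A] that gives half-open intervals their length, which
    characterises Lebesgue measure. *)
Lemma lebesgue_measure_affine (a r : R) (A : set R) : (0 < r)%R ->
  measurable A ->
  mu A = r%:E * mu ((fun x : R => (a + r * x)%R) @^-1` A).
Proof.
move=> r0 mA.
pose f : measurableTypeR R -> measurableTypeR R := fun x => (a + r * x)%R.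
have mf : measurable_fun [set: measurableTypeR R] f.
  by apply: measurable_funD => //; exact: measurable_funM.
pose r' := NngNum (ltW r0).
pose nu := measure_function_pushforward__canonical__measure_function_Measure
  mu mf.
apply: (@lebesgue_measure_unique R (mscale r' nu)) => // _ [[u v]] _ <-.
have fE : f @^-1` `]u, v]%classic = `]((u - a) / r)%R, ((v - a) / r)%R]%classic.
  apply/seteqP; split => x; rewrite /f/= !in_itv/= ltr_pdivrMr// ler_pdivlMr//.
    by move=> /andP[h1 h2]; apply/andP; split; lra.
  by move=> /andP[h1 h2]; apply/andP; split; lra.
rewrite [RHS](_ : _ = r%:E * mu `]((u - a) / r)%R, ((v - a) / r)%R]%classic);
  last by rewrite -fE.
rewrite !lebesgue_measure_itv/= !lte_fin ltr_pM2r ?invr_gt0// ltrD2r.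
case: ifPn => _; last by rewrite mule0.
rewrite -EFinM; congr EFin; field.
by rewrite gt_eqF.
Qed.

Definition closed_ball_tuple d (x : d.-tuple R) (r : R) : set (d.-tuple R) :=
  [set p | (eucl_dist p x <= r)%R].

Lemma measurable_eucl_dist d d' (U : measurableType d')
    (f g : U -> d.-tuple R) :
  measurable_fun setT f -> measurable_fun setT g ->
  measurable_fun [set: U] (fun u => eucl_dist (f u) (g u)).
Proof.
move=> mf mg; rewrite /eucl_dist /eucl_norm.
apply: measurableT_comp; first exact: continuous_measurable_fun (@sqrt_continuous R).
apply: measurable_sum => i; apply: measurable_funX.
by apply: measurable_funB; apply: measurableT_comp (Defs.measurable_tnth i) _.
Qed.

End lebesgue_ball.

(** * Euclidean balls *)

Section lebesgue_ball_volume.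
Context {R : realType}.
Local Notation mu := (@lebesgue_measure R).

Lemma measurable_eucl_norm d :
  measurable_fun [set: d.-tuple R] (fun t => eucl_norm (tnth t)).
Proof.
rewrite /eucl_norm; apply: measurableT_comp.
  exact: continuous_measurable_fun (@sqrt_continuous R).
by apply: measurable_sum => i; apply: measurable_funX; exact: Defs.measurable_tnth.
Qed.

Lemma eucl_norm_coord d (v : 'I_d -> R) i : `|v i| <= eucl_norm v.
Proof.
rewrite /eucl_norm -sqrtr_sqr; apply: ler_wsqrtr.
by rewrite (bigD1 i)//= lerDl sumr_ge0// => j _; exact: sqr_ge0.
Qed.

Lemma eucl_norm_ge0 d (v : 'I_d -> R) : 0 <= eucl_norm v.
Proof. exact: sqrtr_ge0. Qed.

Lemma eucl_norm_le d (v : 'I_d -> R) a : 0 <= a ->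
  (forall i, `|v i| <= a) -> eucl_norm v <= Num.sqrt d%:R * a.
Proof.
move=> a0 va; rewrite /eucl_norm -[in leRHS](ger0_norm a0) -sqrtr_sqr.
rewrite -sqrtrM ?ler0n//; apply: ler_wsqrtr.
apply: (@le_trans _ _ (\sum_(i < d) a ^+ 2)).
  by apply: ler_sum => i _; rewrite -(real_normK (num_real (v i))) ler_sqr ?nnegrE.
by rewrite sumr_const card_ord mulr_natl.
Qed.

Definition tuple_cube d (a b : R) : set (d.-tuple R) :=
  tuple_box (fun _ => `[a, b]%classic : set R).

Lemma measurable_tuple_cube d (a b : R) : measurable (@tuple_cube d a b).
Proof. by apply: measurable_tuple_box => i; exact: measurable_itv. Qed.

Lemma tuple_lebesgue_cube d (a b : R) : a <= b ->
  tuple_power mu d (@tuple_cube d a b) = ((b - a) ^+ d)%:E.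
Proof.
move=> ab; rewrite [LHS](tuple_power_box mu (fun _ : 'I_d => measurable_itv _)).
rewrite (eq_bigr (fun=> (b - a)%:E)); last first.
  move=> i _; rewrite [LHS](lebesgue_measure_itv `[a, b])/= lte_fin.
  by move: ab; rewrite le_eqVlt => /predU1P[->|->//]; rewrite ltxx subrr.
by rewrite prodEFin prodr_const card_ord.
Qed.

Local Notation unit_ball d := [set x : d.-tuple R | eucl_norm (tnth x) <= 1].

Lemma measurable_unit_ball d : measurable (unit_ball d).
Proof.
rewrite -[X in measurable X]setTI.
exact: measurable_fun_le (@measurable_eucl_norm d) (measurable_cst _).
Qed.

Lemma unit_ball_volumeE d :
  tuple_power mu d (unit_ball d) = (unit_ball_volume d)%:E.
Proof.
rewrite /unit_ball_volume fineK// ge0_fin_numE//.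
have : (tuple_power mu d (unit_ball d) <=
    tuple_power mu d (@tuple_cube d (-1)%R 1%R))%E.
  apply: le_measure; rewrite ?inE.
  - exact: measurable_unit_ball.
  - exact: measurable_tuple_cube.
  - move=> x /= x1 i; rewrite /= in_itv/= -ler_norml.
    exact: le_trans (eucl_norm_coord _ i) x1.
rewrite tuple_lebesgue_cube; last by lra.
by move=> /le_lt_trans; apply; exact: ltry.
Qed.

(** The ball contains the cube of half-side 1 / sqrt d. This gives positivity of the volume, and the
    bound 2 when d = 1. *)
Lemma unit_ball_volume_ge d : (0 < d)%N ->
  (2 / Num.sqrt d%:R) ^+ d <= unit_ball_volume d :> R.
Proof.
move=> d0; set s : R := Num.sqrt d%:R.
have s0 : 0 < s by rewrite sqrtr_gt0 ltr0n.
rewrite -lee_fin -unit_ball_volumeE.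
rewrite (_ : 2 / s = s^-1 - - s^-1); last by rewrite opprK -mulr2n mulr_natl.
rewrite -tuple_lebesgue_cube; last first.
  by apply: (@le_trans _ _ 0); rewrite ?oppr_le0 invr_ge0 ltW.
apply: le_measure; rewrite ?inE.
- exact: measurable_tuple_cube.
- exact: measurable_unit_ball.
move=> x xs; rewrite /=.
rewrite -(divff (lt0r_neq0 s0)) eucl_norm_le// ?invr_ge0 ?ltW// => i.
by have := xs i; rewrite /= in_itv/= ler_norml.
Qed.

Lemma unit_ball_volume_gt0 d : (0 < d)%N -> 0 < unit_ball_volume d :> R.
Proof.
move=> d0; apply: lt_le_trans (unit_ball_volume_ge d0).
by rewrite exprn_gt0// divr_gt0// sqrtr_gt0 ltr0n.
Qed.

Lemma measurable_closed_ball_tuple d (x : d.-tuple R) r :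
  measurable (closed_ball_tuple x r).
Proof.
rewrite -[X in measurable X]setTI.
have h : measurable_fun [set: d.-tuple R] (fun p => eucl_dist p x).
  apply: (@measurable_eucl_dist R d _ _ (fun p : d.-tuple R => p) (fun _ => x)) => //.
exact: measurable_fun_le h (measurable_cst _).
Qed.

Definition tuple_affine d (a : d.-tuple R) (r : R) (p : d.-tuple R) :
  d.-tuple R := [tuple tnth a i + r * tnth p i | i < d].

Lemma measurable_tuple_affine d (a : d.-tuple R) (r : R) :
  measurable_fun [set: d.-tuple (measurableTypeR R)]
    (tuple_affine a r : _ -> d.-tuple (measurableTypeR R)).
Proof.
apply: Defs.measurable_fun_tnthP => i.
rewrite (_ : (fun _ => _) = (fun t : d.-tuple R => tnth a i + r * tnth t i)).
  apply: measurable_funD => //; apply: measurable_funM => //.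
  exact: Defs.measurable_tnth.
by apply/funext => t; rewrite tnth_mktuple.
Qed.

(** On a box the one-dimensional scaling applies to each side and contributes a factor [r] per
    coordinate; uniqueness on boxes does the rest. *)
Lemma tuple_lebesgue_affine d (a : d.-tuple R) (r : R) A : 0 < r ->
  measurable A ->
  tuple_power mu d A =
    ((r ^+ d)%:E * tuple_power mu d (tuple_affine a r @^-1` A))%E.
Proof.
move=> r0 mA.
have rd0 : 0 <= r ^+ d by rewrite exprn_ge0// ltW.
pose nu := measure_function_pushforward__canonical__measure_function_Measure
  (tuple_power mu d) (measurable_tuple_affine a r).
pose kappa := measure_function_mscale__canonical__measure_function_Measure
  (NngNum rd0) nu.
suff -> : tuple_power mu d A = mscale (NngNum rd0) nu A by [].
apply: (@tuple_power_unique _ _ _ mu d kappa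
  (fun j => `[- j%:R, j%:R]%classic)) => //.
- move=> j; rewrite [X in (X < _)%E](lebesgue_measure_itv `[- j%:R, j%:R])/=.
  by case: ifP => _; rewrite ltry.
- move=> i j ij; apply/subsetPset => x /=; rewrite !in_itv/= => /andP[ix xi].
  have : i%:R <= j%:R :> R by rewrite ler_nat.
  by move=> ?; apply/andP; split; lra.
- rewrite -subTset => x _; exists (Num.truncn `|x|).+1 => //=.
  rewrite in_itv/= -ler_norml ltW//.
  by have /andP[_] := truncn_itv (normr_ge0 x).
move=> B mB.
transitivity ((r ^+ d)%:E *
    tuple_power mu d (tuple_affine a r @^-1` tuple_box B))%E => //.
rewrite (_ : tuple_affine a r @^-1` _ =
    tuple_box (fun i => (fun x => tnth a i + r * x) @^-1` B i)); last first.
  by apply/seteqP; split => t Bt i; have := Bt i; rewrite tnth_mktuple.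
have mf i : measurable ((fun x => tnth a i + r * x) @^-1` B i).
  rewrite -[X in measurable X]setTI.
  have : measurable_fun [set: R] (fun x => tnth a i + r * x).
    by apply: measurable_funD => //; exact: measurable_funM.
  by move=> h; exact: h measurableT _ (mB i).
rewrite [X in (_ * X)%E](tuple_power_box mu mf).
rewrite [RHS](eq_bigr _ (fun i _ => lebesgue_measure_affine (tnth a i) r0 (mB i))).
rewrite big_split/= prodEFin prodr_const card_ord; congr (_ * _)%E.
Qed.

Lemma lebesgue_closed_ball_tuple d (x : d.-tuple R) r : 0 < r ->
  tuple_power mu d (closed_ball_tuple x r) = (r ^+ d * unit_ball_volume d)%:E.
Proof.
move=> r0; rewrite (tuple_lebesgue_affine x r0)//; last first.
  exact: measurable_closed_ball_tuple.
rewrite EFinM -unit_ball_volumeE; congr (_ * tuple_power mu d _)%E.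
apply/seteqP; split => p; rewrite /closed_ball_tuple/=.
all: rewrite (_ : eucl_dist _ _ = r * eucl_norm (tnth p));
  first by rewrite ger_pMr.
all: rewrite /eucl_dist /eucl_norm -{2}(ger0_norm (ltW r0)) -sqrtr_sqr.
all: rewrite -sqrtrM ?sqr_ge0//.
all: rewrite mulr_sumr; congr Num.sqrt; apply: eq_bigr => i _.
all: by rewrite tnth_mktuple addrC addKr exprMn.
Qed.

End lebesgue_ball_volume.

(** * Nearest neighbour distances *)

Section knn_radius.
Context {R : realType} {d : nat}.
Local Notation X := (d.-tuple R).
Local Notation mu := (@lebesgue_measure R).

Lemma measurable_natr_bool d' (U : measurableType d') (f : U -> bool) :
  measurable_fun [set: U] f -> measurable_fun [set: U] (fun u => (f u)%:R : R).
Proof. by move=> mf; apply: (measurableT_comp (f := fun b : bool => b%:R : R)). Qed.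

Lemma eucl_dist_ge0 (x y : X) : 0 <= eucl_dist x y.
Proof. exact: eucl_norm_ge0. Qed.

Lemma eucl_distxx (x : X) : eucl_dist x x = 0.
Proof.
rewrite /eucl_dist /eucl_norm big1 ?sqrtr0// => i _.
by rewrite subrr expr0n.
Qed.

Lemma eucl_distC (x y : X) : eucl_dist x y = eucl_dist y x.
Proof.
rewrite /eucl_dist /eucl_norm; congr Num.sqrt; apply: eq_bigr => i _.
by rewrite -sqrrN opprB.
Qed.

Lemma sqr_eucl_dist (x y : X) :
  eucl_dist x y ^+ 2 = \sum_(i < d) (tnth x i - tnth y i) ^+ 2.
Proof. by rewrite sqr_sqrtr// sumr_ge0// => i _; exact: sqr_ge0. Qed.

(** In each coordinate the two sides differ by the square (a - 2 b + c)^2, so neither the triangle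
    inequality nor Cauchy-Schwarz is involved. *)
Lemma sqr_eucl_distD (x y z : X) :
  eucl_dist x z ^+ 2 <= 2 * eucl_dist x y ^+ 2 + 2 * eucl_dist y z ^+ 2.
Proof.
rewrite !sqr_eucl_dist !mulr_sumr -big_split/=; apply: ler_sum => i _.
move: (tnth x i) (tnth y i) (tnth z i) => a b c; have := sqr_ge0 (a - 2 * b + c); nra.
Qed.

Lemma eucl_dist_unit_cube (x y : X) : unit_cube x -> unit_cube y ->
  eucl_dist x y <= Num.sqrt d%:R.
Proof.
move=> cx cy; rewrite -[leRHS]mulr1; apply: eucl_norm_le => // i.
have /andP[] := cx i; have /andP[] := cy i => *.
by rewrite ler_norml; apply/andP; split; lra.
Qed.

(* The [nth] default 0 is reached only when [N <= k]. *)
Definition knn_radius N (k : nat) (x : 'I_N -> X) (i : 'I_N) : R :=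
  nth 0 (sort <=%R [seq eucl_dist (x j) (x i) | j <- enum 'I_N]) k.

Section knn_radius_count.
Variables (N k : nat) (x : 'I_N -> X) (i : 'I_N).
Hypothesis kN : (k < N)%N.
Let s := sort <=%R [seq eucl_dist (x j) (x i) | j <- enum 'I_N].

Let size_s : size s = N.
Proof. by rewrite size_sort size_map size_enum_ord. Qed.

Let sorted_s : sorted <=%O s. Proof. exact: sort_le_sorted. Qed.

Let count_s (p : pred R) : count p s = #|[pred j | p (eucl_dist (x j) (x i))]|.
Proof.
rewrite /s (seq.permP (permEl (perm_sort _ _))) count_map enumT cardE /enum_mem.
by rewrite size_filter; apply: eq_count => j.
Qed.

(** The point [x i] occurs in its own list at distance 0. Entry [k], counted from 0, is therefore
    the distance to the [k]-th neighbour among the other points, and the counts here and below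
    include [i]. *)
Lemma card_le_knn_radius :
  (k < #|[pred j | (eucl_dist (x j) (x i) <= knn_radius k x i)%R]|)%N.
Proof.
rewrite ltnNge; apply/negP => h.
have := @nth_count_gt _ _ (knn_radius k x i) 0 s k sorted_s.
by rewrite count_s h size_s kN ltxx => /(_ isT).
Qed.

Lemma card_lt_knn_radius :
  (#|[pred j | (eucl_dist (x j) (x i) < knn_radius k x i)%R]| <= k)%N.
Proof.
rewrite leqNgt; apply/negP => h.
have := @nth_count_lt _ _ (knn_radius k x i) 0 s k sorted_s.
by rewrite count_s h ltxx => /(_ isT).
Qed.

(** Describes the superlevel sets of the radius by a count, from which its measurability follows
    without looking into the sort. *)
Lemma knn_radius_gt t : (t < knn_radius k x i) =
  (#|[pred j | (eucl_dist (x j) (x i) <= t)%R]| <= k)%N.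
Proof.
apply/idP/idP => [h|h].
  rewrite leqNgt; apply/negP => kt.
  have := @nth_count_le _ _ t 0 s k sorted_s.
  by rewrite count_s kt => /(_ isT); rewrite leNgt h.
have := @nth_count_gt _ _ t 0 s k sorted_s.
by rewrite count_s h size_s kN => /(_ isT).
Qed.

Lemma knn_radiusP : exists j, knn_radius k x i = eucl_dist (x j) (x i).
Proof.
have : knn_radius k x i \in s by rewrite mem_nth// size_s.
by rewrite mem_sort => /mapP[j _ ->]; exists j.
Qed.

End knn_radius_count.

(** The sorted list forgets the labels of the points. With exchangeability, this makes the radii of
    all points have equal moments. *)
Lemma knn_radius_perm N k (x : 'I_N -> X) (g : 'S_N) i :
  knn_radius k (x \o g) i = knn_radius k x (g i).
Proof.
rewrite /knn_radius; congr (nth _ _ _); apply/perm_sort_leP.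
have -> : [seq eucl_dist ((x \o g) j) ((x \o g) i) | j <- enum 'I_N] =
  [seq eucl_dist (x j) (x (g i)) | j <- map g (enum 'I_N)].
  by rewrite -[RHS]map_comp.
apply: perm_map; apply: uniq_perm; rewrite ?enum_uniq//.
  by rewrite map_inj_uniq ?enum_uniq//; exact: perm_inj.
move=> j; rewrite mem_enum inE; apply/mapP; exists ((g^-1)%g j).
  by rewrite mem_enum.
by rewrite permKV.
Qed.

Lemma measurable_knn_radius d' (U : measurableType d') N k
    (x : 'I_N -> U -> X) i : (k < N)%N ->
  (forall j, measurable_fun [set: U] (x j)) ->
  measurable_fun [set: U] (fun u => knn_radius k (x ^~ u) i).
Proof.
move=> kN mx; apply: (measurability _ (RGenOInfty.measurableE R)) => //.
move=> _ [_ [t ->] <-]; rewrite setTI.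
rewrite (_ : _ @^-1` _ = [set u | (\sum_(j < N)
    (eucl_dist (x j u) (x i u) <= t)%R%:R <= k%:R :> R)%R]).
  rewrite -[X in measurable X]setTI; apply: measurable_fun_le => //.
  apply: measurable_sum => j; apply: measurable_natr_bool.
  by apply: measurable_fun_ler => //; exact: measurable_eucl_dist.
have cardE' u : \sum_(j < N) (eucl_dist (x j u) (x i u) <= t)%R%:R =
    #|[pred j | (eucl_dist (x j u) (x i u) <= t)%R]|%:R :> R.
  rewrite -sum1_card natr_sum [RHS]big_mkcond/=; apply: eq_bigr => j _.
  by rewrite inE; case: ifP.
by apply/seteqP; split => u;
  rewrite /= in_itv/= andbT knn_radius_gt// cardE' ler_nat.
Qed.

End knn_radius.

(** * Packing of balls *)

Section multiplicity.
Context {dT : measure_display} {T : measurableType dT} {R : realType}.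
Variable m : {measure set T -> \bar R}.
Local Open Scope ereal_scope.

(** Integrate the pointwise inequality between the sum of the indicators of the [B i] and [k] times
    the indicator of [C]. *)
Lemma sum_measure_le_multiplicity (I : finType) (B : I -> set T) (C : set T)
    (k : nat) :
  (forall i, measurable (B i)) -> measurable C ->
  (forall i, B i `<=` C) ->
  (forall p, (#|[pred i | `[< B i p >]]| <= k)%N) ->
  \sum_(i : I) m (B i) <= k%:R%:E * m C.
Proof.
move=> mB mC BC Bk.
rewrite (eq_bigr (fun i => \int[m]_p (\1_(B i) p)%:E)); last first.
  by move=> i _; rewrite integral_indic// setIT.
have mI i : measurable_fun setT (fun p => (\1_(B i) p)%:E : \bar R).
  exact/measurable_EFinP.
rewrite -(ge0_integral_sum m measurableT mI); last by move=> *; rewrite lee_fin.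
rewrite -[m C](_ : \int[m]_p (\1_C p)%:E = _); last by rewrite integral_indic// setIT.
rewrite -ge0_integralZl//; last by apply/measurable_EFinP.
apply: ge0_le_integral => //.
- by move=> p _; apply: sume_ge0 => i _; rewrite lee_fin.
- by apply: emeasurable_sum => i; apply/measurable_EFinP.
- by apply: measurable_funeM; apply/measurable_EFinP.
move=> p _; rewrite sumEFin -EFinM lee_fin indicE.
have [Cp|Cp] := boolP (p \in C); last first.
  rewrite mulr0 big1// => i _; rewrite indicE memNset// => Bp.
  by move/negP: Cp; apply; rewrite inE; exact: BC Bp.
rewrite mulr1; apply: (@le_trans _ _ (#|[pred i | `[< B i p >]]|%:R)%R); last first.
  by rewrite ler_nat; exact: Bk p.
rewrite -sum1_card natr_sum [leRHS]big_mkcond/=; apply: ler_sum => i _.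
by rewrite indicE inE; case: asboolP => h; [rewrite mem_set|rewrite memNset].
Qed.

End multiplicity.

Section packing.
Context {R : realType} {d : nat}.
Local Notation X := (d.-tuple R).
Local Notation mu := (@lebesgue_measure R).
Hypothesis d0 : (0 < d)%N.

Variables (N k : nat) (x : 'I_N -> X).
Hypothesis kN : (k < N)%N.
Hypothesis x_cube : forall i, unit_cube (x i).

Local Notation r := (knn_radius k x).

Lemma knn_radius_ge0 i : 0 <= r i.
Proof. by have [j ->] := knn_radiusP x i kN; exact: eucl_dist_ge0. Qed.

Lemma knn_radius_le i : r i <= Num.sqrt d%:R.
Proof. by have [j ->] := knn_radiusP x i kN; exact: eucl_dist_unit_cube. Qed.

Let s8 : R := Num.sqrt 8.

Let s8_gt0 : 0 < s8. Proof. by rewrite sqrtr_gt0. Qed.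

Let s8_ge2 : 2 <= s8.
Proof.
rewrite -(@ler_sqr _ 2)// ?nnegrE ?ltW// sqr_sqrtr//; lra.
Qed.

(** Radius zero occurs when points coincide. A degenerate closed ball would then contain its centre,
    and more than [k] of them could meet there; the empty set avoids this at no cost in volume. *)
Let B i : set (d.-tuple (measurableTypeR R)) :=
  if r i > 0 then closed_ball_tuple (x i) (r i / s8) else set0.

Let B_multiplicity p : (#|[pred i | `[< B i p >]]| <= k)%N.
Proof.
have [[i0 Bi0]|noB] := pselect (exists i, B i p); last first.
  rewrite (@eq_card0 _ _)// => i; rewrite !inE; apply/negbTE/negP => /asboolP Bi.
  by apply: noB; exists i.
have Bi0' : `[< B i0 p >] by exact/asboolP.
case: (@Order.TotalTheory.arg_maxP _ _ _ i0 (fun i => `[< B i p >]) r Bi0').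
move=> i /asboolP Bi imax.
apply: leq_trans (card_lt_knn_radius k x i).
apply/subset_leq_card/fintype.subsetP => j; rewrite !inE => Bj.
have rji : r j <= r i by apply: imax; exact/asboolP.
move: Bi Bj; rewrite /B.
case: ifPn => // ri0 pi; case: ifPn => // rj0; rewrite /closed_ball_tuple/= => pj.
have pi2 : eucl_dist p (x i) ^+ 2 <= r i ^+ 2 / 8.
  rewrite -(@sqr_sqrtr _ 8)// -expr_div_n ler_sqr// ?nnegrE ?eucl_dist_ge0//.
  exact: divr_ge0 (ltW ri0) (ltW s8_gt0).
have pj2 : eucl_dist (x j) p ^+ 2 <= r i ^+ 2 / 8.
  rewrite -(@sqr_sqrtr _ 8)// -expr_div_n ler_sqr// ?nnegrE ?eucl_dist_ge0//.
    rewrite eucl_distC; apply: le_trans pj _.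
    by rewrite ler_pM2r// invr_gt0.
  exact: divr_ge0 (ltW ri0) (ltW s8_gt0).
(* The two bounds add up to 2/8 + 2/8 = 1/2 of the square of [r i]. The inequality is strict because
   [r i] is positive, as the count of strictly closer points demands. *)
rewrite -ltr_sqr ?nnegrE ?eucl_dist_ge0 ?ltW//.
have := sqr_eucl_distD (x j) p (x i).
have : 0 < r i ^+ 2 by rewrite exprn_gt0.
lra.
Qed.

Lemma knn_radius_packing :
  unit_ball_volume d * \sum_(i < N) r i ^+ d <=
  k%:R * (Num.sqrt 8 * (1 + Num.sqrt d%:R)) ^+ d.
Proof.
set q : R := Num.sqrt d%:R.
have q0 : 0 <= q by exact: sqrtr_ge0.
(* Each radius is at most sqrt d / sqrt 8 <= q / 2, hence a margin of q / 2 on both sides of the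
   unit cube. *)
pose C := @tuple_cube R d (- (q / 2)) (1 + q / 2).
have mB i : measurable (B i).
  rewrite /B; case: ifPn => // _.
  exact: measurable_closed_ball_tuple.
have mC : measurable C by exact: measurable_tuple_cube.
have BC i : B i `<=` C.
  rewrite /B; case: ifPn => [ri|_]; last exact: sub0set.
  move=> p pi c /=; rewrite in_itv/=.
  have /andP[xc0 xc1] := x_cube i c.
  have : `|tnth p c - tnth (x i) c| <= q / 2.
    apply: le_trans (eucl_norm_coord (fun c => tnth p c - tnth (x i) c) c) _.
    apply: le_trans pi _; apply: ler_pM; rewrite ?invr_ge0 ?knn_radius_ge0//.
    - exact: ltW.
    - exact: knn_radius_le.
    - by rewrite lef_pV2// posrE.
  by rewrite ler_norml => /andP[? ?]; apply/andP; split; lra.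
have := sum_measure_le_multiplicity (tuple_power mu d) mB mC BC B_multiplicity.
rewrite (eq_bigr (fun i => ((r i / s8) ^+ d * unit_ball_volume d)%:E)); last first.
  move=> i _; rewrite /B; case: ifPn => ri.
    by rewrite [LHS](lebesgue_closed_ball_tuple (x i) (divr_gt0 ri s8_gt0)).
  rewrite (_ : r i = 0) ?mul0r ?expr0n ?gtn_eqF// ?mul0r ?measure0//.
  by apply/eqP; rewrite eq_le knn_radius_ge0 andbT leNgt.
rewrite sumEFin [X in (_ <= _ * X)%E](tuple_lebesgue_cube d (a := - (q / 2))
  (b := 1 + q / 2)); last by lra.
rewrite -EFinM lee_fin (_ : 1 + q / 2 - - (q / 2) = 1 + q); last by field.
move=> h.
rewrite exprMn mulrCA -ler_pdivrMl ?exprn_gt0//; apply: le_trans h.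
rewrite mulr_sumr mulr_sumr; apply: ler_sum => i _.
by rewrite expr_div_n le_eqVlt; apply/orP; left; apply/eqP; rewrite /s8; ring.
Qed.

End packing.

(** * Moments of the nearest neighbour distance *)

Section moments.
Context {dT : measure_display} {T : measurableType dT} {R : realType}.

(** The right-hand side is the tangent line at [c] of the concave map t ^ a. *)
Lemma young_powR (t c a : R) : 0 <= t -> 0 < c -> 0 < a <= 1 ->
  t `^ a <= c `^ (a - 1) * (a * t + (1 - a) * c).
Proof.
move=> t0 c0 /andP[a0]; rewrite le_eqVlt => /predU1P[->|a1].
  by rewrite subrr powRr0 powRr1// mul1r mul0r addr0 mul1r.
have a1' : 0 < 1 - a by lra.
have h : t `^ a * c `^ (1 - a) <= a * t + (1 - a) * c.
  (* Young's inequality with conjugate exponents 1 / a and 1 / (1 - a). *)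
  have := @conjugate_powR R (t `^ a) (c `^ (1 - a)) a^-1 (1 - a)^-1.
  rewrite !powR_ge0 !invr_gt0 a0 a1' !invrK addrC subrK => /(_ isT isT isT isT erefl).
  rewrite -!powRrM !divff ?gt_eqF// !powRr1//; last exact: ltW.
  by rewrite [t * a]mulrC [c * _]mulrC.
rewrite -[leRHS](mulrC (a * t + _)) -(opprB 1 a) powRN ler_pdivlMr//.
by rewrite powR_gt0.
Qed.

(** Jensen's inequality for a concave power, by integrating the tangent line. The tangency point is
    the upper bound [c] rather than the mean itself, so the mean need not be computed and may be
    zero. *)
Lemma le_integral_powR (mu : {measure set T -> \bar R}) (f : T -> R) (c a : R) :
  (mu setT = 1)%E -> measurable_fun setT f -> (forall t, 0 <= f t) ->
  0 < c -> 0 < a <= 1 ->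
  (\int[mu]_t (f t)%:E <= c%:E)%E ->
  (\int[mu]_t (f t `^ a)%:E <= (c `^ a)%:E)%E.
Proof.
move=> mu1 mf f0 c0 a01 fc; have /andP[a0 a1] := a01.
have ca : 0 <= c `^ (a - 1) by exact: powR_ge0.
apply: (@le_trans _ _ (\int[mu]_t ((c `^ (a - 1))%:E *
    (a%:E * (f t)%:E + ((1 - a) * c)%:E)))%E).
  apply: ge0_le_integral => //.
  - by move=> t _; rewrite lee_fin powR_ge0.
  - apply/measurable_EFinP; exact: (measurableT_comp (@measurable_powR R a) mf).
  - apply/measurable_EFinP; apply: measurable_funM => //.
    by apply: measurable_funD => //; apply: measurable_funM.
  - move=> t _; rewrite [leRHS](_ : _ = (c `^ (a - 1) * (a * f t + (1 - a) * c))%:E)//.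
    by rewrite lee_fin young_powR.
have ac0 : 0 <= (1 - a) * c by rewrite mulr_ge0 ?subr_ge0 ?(ltW c0).
have mf' : measurable_fun setT (fun t => (f t)%:E) by exact/measurable_EFinP.
have maf : measurable_fun setT (fun t => (a%:E * (f t)%:E)%E).
  exact: measurable_funeM.
have mg : measurable_fun setT (fun t => (a%:E * (f t)%:E + ((1 - a) * c)%:E)%E).
  exact: emeasurable_funD.
have af0 t : (0 <= a%:E * (f t)%:E)%E by rewrite mule_ge0 ?lee_fin ?(ltW a0).
have g0 t : (0 <= a%:E * (f t)%:E + ((1 - a) * c)%:E)%E.
  by rewrite adde_ge0// lee_fin.
rewrite ge0_integralZl// ge0_integralD// ge0_integralZl//; last 2 first.
- by move=> t _; rewrite lee_fin.
- by rewrite lee_fin ltW.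
rewrite integral_cst// [X in (_ + _ * X)%E]mu1 mule1.
apply: (@le_trans _ _ ((c `^ (a - 1))%:E * (a%:E * c%:E + ((1 - a) * c)%:E))%E).
  by rewrite lee_wpmul2l ?lee_fin// leeD2r// lee_wpmul2l// lee_fin ltW.
rewrite [leLHS](_ : _ = (c `^ (a - 1) * (a * c + (1 - a) * c))%:E)// lee_fin.
rewrite -mulrDl (_ : a + (1 - a) = 1); last by ring.
by rewrite mul1r mulrC mulr_powRB1// ltW.
Qed.

(** A box whose sides all have probability one has probability one. *)
Lemma tuple_power_ae (P : probability T R) n (Q : T -> Prop) :
  {ae P, forall u, Q u} -> {ae tuple_power P n, forall t, forall i, Q (tnth t i)}.
Proof.
move=> [A [mA PA0 QA]].
exists (~` tuple_box (fun _ : 'I_n => ~` A)); split.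
- by apply: measurableC; apply: measurable_tuple_box => i; exact: measurableC.
- have mAC : measurable (tuple_box (fun _ : 'I_n => ~` A)).
    by apply: measurable_tuple_box => i; exact: measurableC.
  have box1 : (tuple_power P n (tuple_box (fun _ : 'I_n => ~` A)) = 1)%E.
    rewrite [LHS](tuple_power_box P (fun _ : 'I_n => measurableC mA)).
    by rewrite big1// => i _; rewrite [LHS]probability_setC// PA0 sube0.
  have := measureD (mu := tuple_power P n) measurableT mAC.
  rewrite setTD setTI => ->.
    by rewrite [X in (X - _)%E](tuple_power_setT P n) [X in (_ - X)%E]box1 subee.
  by rewrite [X in (X < _)%E](tuple_power_setT P n) ltry.
apply: subsetC => t tA i; apply: contrapT => nQ.
by apply: (tA i); apply: QA.
Qed.

End moments.

Section knn_radius_moment.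
Context {R : realType} {d : nat}.
Variable P : probability (d.-tuple R * R)%type R.
Hypothesis d0 : (0 < d)%N.
Hypothesis P_cube : {ae P, forall u, unit_cube u.1}.
Variables (n k : nat).
Hypothesis kn : (0 < k <= n)%N.
Local Notation N := n.+1.

(** The test point is adjoined to the sample as entry 0, so [sample_radius ord0] is its distance to
    its [k]-th neighbour in the sample. *)
Definition sample_radius (i : 'I_N) (t : N.-tuple (d.-tuple R * R)) : R :=
  knn_radius k (fun j => (tnth t j).1) i.

Let kN : (k < N)%N. Proof. by rewrite ltnS; case/andP: kn. Qed.

Lemma sample_radius_ge0 i t : 0 <= sample_radius i t.
Proof.
by rewrite /sample_radius; have [j ->] := knn_radiusP (fun j => (tnth t j).1) i kN;
  exact: eucl_dist_ge0.
Qed.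

Lemma measurable_sample_radius i :
  measurable_fun [set: N.-tuple (d.-tuple R * R)] (sample_radius i).
Proof.
apply: (measurable_knn_radius (x := fun j t => (tnth t j).1)) => // j.
exact: measurableT_comp measurable_fst (Defs.measurable_tnth j).
Qed.

Let V : R := unit_ball_volume d.

Let V_gt0 : 0 < V. Proof. exact: unit_ball_volume_gt0. Qed.

Lemma sample_radius_moment :
  (\int[tuple_power P N]_t (sample_radius ord0 t ^+ d)%:E <=
   (k%:R / N%:R * (Num.sqrt 8 * (1 + Num.sqrt d%:R)) ^+ d / V)%:E)%E.
Proof.
have mr i : measurable_fun [set: N.-tuple (d.-tuple R * R)]
    (fun t => (sample_radius i t ^+ d)%:E).
  by apply/measurable_EFinP; apply: measurable_funX; exact: measurable_sample_radius.
have r0 i t : (0 <= (sample_radius i t ^+ d)%:E)%E.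
  by rewrite lee_fin exprn_ge0// sample_radius_ge0.
(* The transposition of 0 and [i] turns the radius of entry [i] into that of entry 0. *)
have exch i : (\int[tuple_power P N]_t (sample_radius i t ^+ d)%:E =
    \int[tuple_power P N]_t (sample_radius ord0 t ^+ d)%:E)%E.
  rewrite -[RHS](ge0_integral_tuple_perm P (tperm ord0 i) (mr ord0) (r0 ord0)).
  apply: eq_integral => t _; congr (_ ^+ d)%:E.
  rewrite /sample_radius -[in LHS](tpermL ord0 i) -knn_radius_perm.
  by congr (knn_radius k _ _); apply/funext => j /=; rewrite tnth_mktuple.
set E := (\int[tuple_power P N]_t (sample_radius ord0 t ^+ d)%:E)%E.
pose Q : R := k%:R * (Num.sqrt 8 * (1 + Num.sqrt d%:R)) ^+ d.
have : (N%:R%:E * E <= (Q / V)%:E)%E.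
  rewrite (_ : _ * E = \sum_(i < N)
      \int[tuple_power P N]_t (sample_radius i t ^+ d)%:E)%E; last first.
    by rewrite (eq_bigr (fun _ => E)) ?sumr_const// card_ord mule_natl.
  rewrite -ge0_integral_sum//.
  apply: (@le_trans _ _ (\int[tuple_power P N]_t (Q / V)%:E)%E).
    apply: ae_ge0_le_integral => //.
    - by move=> t _; apply: sume_ge0 => i _.
    - by apply: emeasurable_sum.
    - move=> t _; rewrite lee_fin; apply: divr_ge0; last exact: ltW.
      by apply: mulr_ge0 => //; apply: exprn_ge0; apply: mulr_ge0 => //;
        exact: addr_ge0.
    have := tuple_power_ae N P_cube; apply: filterS => t tcube _.
    rewrite sumEFin lee_fin ler_pdivlMr// mulrC.
    exact: knn_radius_packing.
  by rewrite integral_cst// [X in (_ * X)%E](tuple_power_setT P N) mule1.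
rewrite [X in _ -> (_ <= X)%E](_ : _ = ((N%:R^-1)%:E * (Q / V)%:E)%E); last first.
  by rewrite -EFinM; congr EFin; rewrite /Q; ring.
by rewrite lee_pdivlMl.
Qed.

End knn_radius_moment.

Section knn_radius_bounds.
Context {R : realType} {d : nat}.
Variable P : probability (d.-tuple R * R)%type R.
Hypothesis d0 : (0 < d)%N.
Hypothesis P_cube : {ae P, forall u, unit_cube u.1}.
Variables (n k : nat).
Hypothesis kn : (0 < k <= n)%N.
Variable h : R.
Hypothesis h01 : 0 < h <= 1.
Local Notation N := n.+1.
Local Notation r := (sample_radius k (@ord0 n)).

Let V_gt0 : 0 < unit_ball_volume d :> R.
Proof. exact: unit_ball_volume_gt0. Qed.

Let k_gt0 : 0 < k%:R :> R. Proof. by rewrite ltr0n; case/andP: kn. Qed.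

Let n_gt0 : 0 < n%:R :> R.
Proof. by rewrite ltr0n; case/andP: kn => + ?; move/leq_trans; apply. Qed.

Let kN_le : k%:R / N%:R <= k%:R / n%:R :> R.
Proof. by rewrite ler_pM2l// lef_pV2 ?posrE// ler_nat. Qed.

Let mr : measurable_fun [set: N.-tuple (d.-tuple R * R)] r.
Proof. exact: measurable_sample_radius. Qed.

Lemma sample_radius_powR_ge2 : (2 <= d)%N ->
  (\int[tuple_power P N]_t (r t `^ (2 * h))%:E <=
   (c_ d `^ h * (k%:R / n%:R) `^ (2 * h / d%:R))%:E)%E.
Proof.
move=> d2; have /andP[h0 h1] := h01.
have dR : 0 < d%:R :> R by rewrite ltr0n.
set q : R := Num.sqrt d%:R; have q0 : 0 <= q by exact: sqrtr_ge0.
have q1 : 0 < 1 + q by rewrite ltr_pwDl.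
(* The packing bound on the mean of r ^ d, at which the concave power 2 h / d is evaluated. *)
pose m : R := k%:R / N%:R * (Num.sqrt 8 * (1 + q)) ^+ d / unit_ball_volume d.
have s8 : 0 < Num.sqrt 8 :> R by rewrite sqrtr_gt0.
have m0 : 0 < m.
  rewrite /m !mulr_gt0 ?invr_gt0//; apply: exprn_gt0; exact: mulr_gt0.
have a01 : 0 < 2 * h / d%:R <= 1.
  rewrite divr_gt0 ?mulr_gt0//= ler_pdivrMr// mul1r.
  have d2' : 2 <= d%:R :> R by rewrite (ler_nat R 2).
  by lra.
have := le_integral_powR (tuple_power_setT P N) (measurable_funX d mr)
  (fun t => exprn_ge0 d (sample_radius_ge0 kn ord0 t)) m0 a01
  (sample_radius_moment d0 P_cube kn).
rewrite [X in (X <= _)%E -> _](_ : _ =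
    \int[tuple_power P N]_t (r t `^ (2 * h))%:E)%E; last first.
  apply: eq_integral => t _; rewrite -powR_mulrn ?sample_radius_ge0// -powRrM.
  by congr (_ `^ _)%:E; field; rewrite gt_eqF.
move=> /le_trans; apply; rewrite lee_fin.
have c0 : 0 <= c_ d :> R.
  by rewrite /c_ !mulr_ge0 ?powR_ge0 ?sqr_ge0// invr_ge0 powR_ge0.
rewrite (_ : 2 * h / d%:R = 2 / d%:R * h); last by ring.
rewrite (powRrM m) (powRrM (k%:R / n%:R) (2 / d%:R) h) -powRM ?powR_ge0//.
apply: ge0_ler_powR; rewrite ?nnegrE ?powR_ge0 ?(ltW h0)//.
  by apply: mulr_ge0; rewrite ?powR_ge0.
have kn0 : 0 <= k%:R / n%:R :> R by rewrite divr_ge0// ltW.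
have kN0 : 0 <= k%:R / N%:R :> R by rewrite divr_ge0// ltW.
have td : 0 <= 2 / d%:R :> R by rewrite divr_ge0// ltW.
have sq0 : 0 <= Num.sqrt 8 * (1 + q) by rewrite mulr_ge0 ?ltW.
rewrite /m powRM; last 2 first.
- by rewrite mulr_ge0// exprn_ge0.
- by rewrite invr_ge0 ltW.
rewrite powRM//; last exact: exprn_ge0.
have -> : ((Num.sqrt 8 * (1 + q)) ^+ d) `^ (2 / d%:R) = 8 * (1 + q) ^+ 2.
  rewrite -(powR_mulrn d sq0) -powRrM (_ : d%:R * (2 / d%:R) = 2%:R); last first.
    by field; rewrite gt_eqF.
  by rewrite powR_mulrn// exprMn sqr_sqrtr.
rewrite -(powR_inv1 (ltW V_gt0)) -powRrM mulN1r powRN /c_ -/q.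
set b := unit_ball_volume d `^ _; set y1 := (_ / N%:R) `^ _; set y2 := (_ / n%:R) `^ _.
have b0 : 0 < b by exact: powR_gt0.
have y12 : y1 <= y2 by apply: ge0_ler_powR; rewrite ?nnegrE.
(* The packing argument yields 8 (1 + sqrt d)^2 / V ^ (2 / d), where 8 is the square of sqrt 8;
   [c_ d] has 2 ^ (3 + 2 / d) in its place. *)
have c8 : 8 <= 2 `^ (3 + 2 / d%:R) :> R.
  rewrite (_ : 8 = 2 `^ 3%:R); last by rewrite powR_mulrn//; ring.
  by apply: ler_powR; [lra|rewrite lerDl].
rewrite [leRHS]mulrAC ler_pM2r ?invr_gt0// [leRHS]mulrC.
apply: ler_pM => //; first exact: powR_ge0.
  by apply: mulr_ge0 => //; exact: sqr_ge0.
by rewrite ler_pM2r ?exprn_gt0.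
Qed.

(** The power 2 h of the radius may be convex here. As the radius is at most 1 on the unit interval,
    it is bounded by its power [h], to which concavity applies. *)
Lemma sample_radius_powR1 : d = 1%N ->
  (\int[tuple_power P N]_t (r t `^ (2 * h))%:E <=
   (8 `^ h * (k%:R / n%:R) `^ h)%:E)%E.
Proof.
move=> d1; have /andP[h0 h1] := h01.
have c0 : 0 < 8 * (k%:R / n%:R) :> R by rewrite mulr_gt0// divr_gt0.
apply: (@le_trans _ _ (\int[tuple_power P N]_t (r t `^ h)%:E)%E).
  apply: ae_ge0_le_integral => //.
  - by move=> t _; rewrite lee_fin powR_ge0.
  - by apply/measurable_EFinP; exact: (measurableT_comp (@measurable_powR R _) mr).
  - by move=> t _; rewrite lee_fin powR_ge0.
  - by apply/measurable_EFinP; exact: (measurableT_comp (@measurable_powR R _) mr).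
  have := tuple_power_ae N P_cube; apply: filterS => t tcube _.
  rewrite lee_fin mulrC powRrM -[leRHS]mulr1.
  have r1 : r t <= 1.
    have kN : (k < N)%N by rewrite ltnS; case/andP: kn.
    apply: le_trans (knn_radius_le (x := fun j => (tnth t j).1) kN tcube ord0) _.
    by rewrite [in leLHS]d1 sqrtr1.
  have rh1 : r t `^ h <= 1.
    have one_h : 1 `^ h = 1 :> R by rewrite powR1.
    rewrite -one_h; apply: ge0_ler_powR; rewrite ?nnegrE ?sample_radius_ge0 ?(ltW h0)//.
  rewrite powR_mulrn ?powR_ge0// expr2.
  by apply: ler_wpM2l => //; exact: powR_ge0.
rewrite -powRM//.
apply: le_integral_powR => //; first exact: tuple_power_setT.
  by move=> t; exact: sample_radius_ge0.
have := sample_radius_moment d0 P_cube kn.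
rewrite [X in (X <= _)%E -> _](_ : _ = \int[tuple_power P N]_t (r t)%:E)%E; last first.
  by apply: eq_integral => t _; rewrite [X in _ ^+ X]d1 expr1.
move=> /le_trans; apply; rewrite lee_fin.
(* With V >= 2 and sqrt 8 <= 3, the packing constant 2 sqrt 8 / V is at most 3, below the required
   8. *)
have V2 : 2 <= unit_ball_volume d :> R.
  by have := @unit_ball_volume_ge R d d0; rewrite {1 2}d1 sqrtr1 divr1 expr1.
have s8 : Num.sqrt 8 <= 3 :> R.
  by rewrite -(@ler_sqr _ _ 3) ?nnegrE// sqr_sqrtr//; lra.
have s80 : 0 <= Num.sqrt 8 :> R by exact: sqrtr_ge0.
have -> : (Num.sqrt 8 * (1 + Num.sqrt d%:R)) ^+ d = Num.sqrt 8 * 2 :> R.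
  by rewrite d1 expr1 sqrtr1.
rewrite ler_pdivrMr//.
have kn0 : 0 <= k%:R / n%:R :> R by rewrite divr_ge0// ltW.
have kN0 : 0 <= k%:R / N%:R :> R by rewrite divr_ge0// ltW.
move: kN_le kN0 kn0 V2 s8 s80.
move: (k%:R / N%:R) (k%:R / n%:R) (Num.sqrt 8) (unit_ball_volume d) => y1 y2 s v.
move=> y12 y1_ge0 y2_ge0 v2 s3 s0.
apply: (@le_trans _ _ (y2 * 6)).
  apply: ler_pM => //; first by rewrite mulr_ge0.
  by lra.
by nra.
Qed.

End knn_radius_bounds.

(** The given [k] is the critical point of M / k + A (k / n) ^ a, that is, k ^ (a + 1) = M n ^ a /
    (a A). Dimension one uses a = h, higher dimensions a = 2 h / d. *)
Lemma knn_optimal_bound {R : realType} (a A M k n : R) :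
  0 < a -> 0 < A -> 0 < M -> 0 < n ->
  k = (M / (a * A)) `^ (1 / (a + 1)) * n `^ (a / (a + 1)) ->
  M / k + A * (k / n) `^ a =
  A `^ (1 / (a + 1)) * M `^ (a / (a + 1)) *
    (a `^ (1 / (a + 1)) + a `^ (- (a / (a + 1)))) * n `^ (- (a / (a + 1))).
Proof.
move=> a0 A0 M0 n0 ->.
have a1 : a + 1 != 0 by rewrite gt_eqF// addr_gt0.
(* Through logarithms each term becomes the exponential of an expression linear in ln a, ln A, ln M
   and ln n, and the claim reduces to identities between rational coefficients. *)
have powE x y : 0 < x -> x `^ y = expR (y * ln x).
  by move=> x0; rewrite /powR gt_eqF.
have aA0 : 0 < a * A by exact: mulr_gt0.
have MaA0 : 0 < M / (a * A) by exact: divr_gt0.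
have lnE : ln (M / (a * A)) = ln M - (ln a + ln A) :> R.
  by rewrite lnM ?posrE ?invr_gt0// lnV ?posrE// lnM.
set k' := (_ `^ _ * n `^ _).
have k'E : k' = expR (1 / (a + 1) * (ln M - (ln a + ln A)) + a / (a + 1) * ln n).
  rewrite /k' !powE// lnE expRD.
  reflexivity.
have k'0 : 0 < k' by rewrite k'E expR_gt0.
have -> : M / k' = expR (ln M - ln k') by rewrite expRB !lnK ?posrE.
have -> : A * (k' / n) `^ a = expR (ln A + a * (ln k' - ln n)).
  rewrite powE ?divr_gt0// expRD lnK ?posrE//.
  by rewrite lnM ?posrE ?invr_gt0// lnV ?posrE.
rewrite k'E expRK !powE//.
have distr (x y p q z : R) : x * y * (p + q) * z = x * y * p * z + x * y * q * z.
  by ring.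
by rewrite distr -!expRD; congr (expR _ + expR _); field.
Qed.

(** * Conditional distribution functions *)

Section kernel_fst.
Context {d1 d2 d3 : measure_display} {T1 : measurableType d1}
  {T2 : measurableType d2} {T3 : measurableType d3} {R : realType}.
Variable K : R.-pker T1 ~> T3.

(** The added second component carries the threshold [z] when the conditional distribution function
    is written as the integral of 1{y <= z} against the kernel. This gives its joint measurability
    in [x] and [z]. *)
Definition kernel_fst (p : T1 * T2) : {measure set T3 -> \bar R} := K p.1.

Let measurable_kernel_fst U : measurable U ->
  measurable_fun [set: T1 * T2] (kernel_fst ^~ U).
Proof.
by move=> mU; exact: measurableT_comp (measurable_kernel K U mU) measurable_fst.
Qed.

HB.instance Definition _ := isKernel.Build _ _ _ _ _ kernel_fst
  measurable_kernel_fst.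

Let kernel_fst_prob p : kernel_fst p [set: T3] = 1%E.
Proof. exact: prob_kernel. Qed.

HB.instance Definition _ := Kernel_isProbability.Build _ _ _ _ _
  kernel_fst kernel_fst_prob.

End kernel_fst.

Section weighted_integral.
Context {dU dX : measure_display} {U : measurableType dU}
  {X : measurableType dX} {R : realType}.
Variables (mu : {measure set U -> \bar R}) (p : U -> X) (v w : U -> R).
Hypotheses (mp : measurable_fun setT p) (mv : measurable_fun setT v)
  (mw : measurable_fun setT w).
Hypotheses (v0 : forall u, 0 <= v u) (w0 : forall u, 0 <= w u).
Local Open Scope ereal_scope.

Import HBNNSimple.

Let integral_nnsfun (q : U -> R) (f : {nnsfun X >-> R}) :
  measurable_fun setT q -> (forall u, (0 <= q u)%R) ->
  \int[mu]_u ((f (p u))%:E * (q u)%:E) =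
  \sum_(r \in range f) r%:E * \int[mu]_u ((\1_(f @^-1` [set r]) (p u))%:E * (q u)%:E).
Proof.
move=> mq q0.
have mI r : measurable_fun setT
    (fun u => (\1_(f @^-1` [set r]) (p u))%:E * (q u)%:E).
  apply: emeasurable_funM; last exact/measurable_EFinP.
  by apply/measurable_EFinP; exact: (measurableT_comp _ mp).
transitivity (\int[mu]_u (\sum_(r \in range f)
    r%:E * ((\1_(f @^-1` [set r]) (p u))%:E * (q u)%:E))).
  apply: eq_integral => u _; rewrite [in LHS]fimfunE -EFinM.
  rewrite [X in X%:E](_ : _ = \sum_(r \in range f)
    (r * (\1_(f @^-1` [set r]) (p u) * q u)))%R.
    by rewrite -fsumEFin.
  by rewrite mulrC mulr_fsumr; apply: eq_fsbigr => r _; ring.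
rewrite ge0_integral_fsum//; last 2 first.
- by move=> r; exact: measurable_funeM.
- move=> r u _; rewrite muleA; apply: mule_ge0; last by rewrite lee_fin.
  exact: nnfun_muleindic_ge0.
apply: eq_fsbigr => r; rewrite inE => -[x _ <-].
rewrite ge0_integralZl//; last 2 first.
- by move=> u _; rewrite mule_ge0// lee_fin.
- by rewrite lee_fin.
Qed.

(** Passage from indicators to nonnegative functions by simple functions and monotone convergence.
    It is applied with [v] the indicator of the response and [w] the conditional distribution
    function. *)
Lemma eq_weighted_integral :
  (forall A, measurable A ->
     \int[mu]_u ((\1_A (p u))%:E * (v u)%:E) =
     \int[mu]_u ((\1_A (p u))%:E * (w u)%:E)) ->
  forall f : X -> \bar R, measurable_fun setT f -> (forall x, 0 <= f x) ->
  \int[mu]_u (f (p u) * (v u)%:E) = \int[mu]_u (f (p u) * (w u)%:E).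
Proof.
move=> vw f mf f0.
pose f_ := nnsfun_approx measurableT mf.
have limE (q : U -> R) : measurable_fun setT q -> (forall u, (0 <= q u)%R) ->
    \int[mu]_u (f (p u) * (q u)%:E) =
    limn (fun n => \int[mu]_u ((f_ n (p u))%:E * (q u)%:E)).
  move=> mq q0.
  transitivity (\int[mu]_u limn (fun n => (f_ n (p u))%:E * (q u)%:E)).
    apply: eq_integral => u _; apply/esym/cvg_lim => //.
    by apply: cvgeZr => //; exact: cvg_nnsfun_approx.
  apply: monotone_convergence => //.
  - move=> n; apply: emeasurable_funM; last exact/measurable_EFinP.
    by apply/measurable_EFinP; exact: (measurableT_comp _ mp).
  - by move=> n u _; rewrite mule_ge0// lee_fin.
  - move=> u _ a b ab; apply: lee_wpmul2r; rewrite lee_fin//.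
    exact/lefP/nd_nnsfun_approx.
rewrite !limE//; congr (limn _); apply/funext => n.
rewrite !integral_nnsfun//; apply: eq_fsbigr => r _.
by rewrite vw.
Qed.

End weighted_integral.

Section cond_cdf_theory.
Context {R : realType} {d : nat}.
Local Notation X := (d.-tuple R).
Variable K : R.-pker X ~> R.
Local Notation F := (cond_cdf K).

Lemma cond_cdfE x z : (F x z)%:E = K x `]-oo, z]%classic.
Proof.
rewrite /cond_cdf fineK// ge0_fin_numE//.
apply: (@le_lt_trans _ _ 1%E); last exact: ltry.
rewrite -(prob_kernel (s := K) x); apply: le_measure; rewrite ?inE//.
Qed.

Lemma cond_cdf_ge0 x z : 0 <= F x z.
Proof. by rewrite -lee_fin cond_cdfE. Qed.

Lemma cond_cdf_le1 x z : F x z <= 1.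
Proof.
by rewrite -lee_fin cond_cdfE -(prob_kernel (s := K) x) le_measure ?inE.
Qed.

Lemma measurable_cond_cdf :
  measurable_fun [set: X * R] (fun p => F p.1 p.2).
Proof.
apply/measurable_EFinP.
pose le01 (q : X * R * R) : \bar R := ((q.2 <= q.1.2)%R%:R)%:E.
have mle : measurable_fun setT le01.
  apply/measurable_EFinP; apply: measurable_natr_bool.
  apply: measurable_fun_ler; first exact: measurable_snd.
  exact: measurableT_comp measurable_snd measurable_fst.
rewrite (_ : _ \o _ = fun p => \int[kernel_fst K p]_y le01 (p, y))%E.
  apply: (measurable_fun_integral_finite_kernel le01 (kernel_fst K)) => //.
  by move=> q; rewrite lee_fin.
apply/funext => p /=; rewrite cond_cdfE -(setIT `]-oo, p.2]%classic).
rewrite -[LHS](integral_indic (kernel_fst K p) measurableT)//.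
apply: eq_integral => y _; rewrite indicE; congr ((nat_of_bool _)%:R)%:E.
by apply/idP/idP; rewrite in_setE/= in_itv.
Qed.

Lemma measurable_cond_cdfl z : measurable_fun [set: X] (F ^~ z).
Proof.
exact: (measurableT_comp measurable_cond_cdf (measurable_pair2 z)).
Qed.

End cond_cdf_theory.

Section disintegration.
Context {R : realType} {d : nat}.
Local Notation X := (d.-tuple R).
Variables (P : probability (X * R)%type R) (K : R.-pker X ~> R).
Hypothesis PK : is_cond_distr P K.
Local Notation F := (cond_cdf K).
Local Open Scope ereal_scope.

Lemma measurable_indicator_le z :
  measurable_fun [set: X * R] (fun u => indicator_le u.2 z).
Proof.
by apply: measurable_natr_bool; apply: measurable_fun_ler => //; exact: measurable_snd.
Qed.

(** When [f] is the indicator of [A], both sides equal the probability of A x ]-oo, z]: the left one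
    directly, the right one by disintegration. *)
Lemma integral_cond_cdf z (f : X -> \bar R) :
  measurable_fun setT f -> (forall x, 0 <= f x) ->
  \int[P]_u (f u.1 * (indicator_le u.2 z)%:E) = \int[P]_u (f u.1 * (F u.1 z)%:E).
Proof.
move=> mf f0.
apply: (@eq_weighted_integral _ _ _ _ _ P fst (fun u => indicator_le u.2 z)
  (fun u => F u.1 z)) => //.
- exact: measurable_indicator_le.
- exact: measurableT_comp (measurable_cond_cdfl K z) measurable_fst.
- by move=> u; exact: cond_cdf_ge0.
move=> A mA.
transitivity (P (A `*` `]-oo, z]%classic)).
  rewrite -[in RHS](setIT (_ `*` _)) -integral_indic//; last exact: measurableX.
  apply: eq_integral => -[x y] _; rewrite -EFinM; congr EFin.
  rewrite /indicator_le !indicE/= -natrM mulnb; congr (nat_of_bool _)%:R.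
  apply/idP/idP => [/andP[/set_mem xA yz]|]; rewrite inE/= in_itv//=.
  by move=> [xA yz]; rewrite mem_set.
rewrite PK//.
rewrite ge0_integral_pushforward//; last first.
  by apply: measurable_funTS; exact: measurable_kernel.
rewrite integral_mkcond; apply: eq_integral => -[x y] _ /=.
rewrite patchE indicE.
rewrite (_ : ((x, y) \in _) = (x \in A)).
  by case: ifPn => xA; rewrite /= ?mul1e ?mul0e// cond_cdfE.
by apply/idP/idP; rewrite !inE.
Qed.

End disintegration.

(** * Orthogonality of the centred responses *)

Section response_orthogonality.
Context {R : realType} {d : nat}.
Local Notation X := (d.-tuple R).
Local Notation Z := (X * R)%type.
Variables (P : probability Z R) (K : R.-pker X ~> R).
Hypothesis PK : is_cond_distr P K.
Local Notation F := (cond_cdf K).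

(** Stands for measurability with respect to all covariates and the responses other than the [j]-th.
    In this functional form it survives freezing the first entry, as the induction on the sample
    size requires. *)
Definition free_of_response (S : Type) n (j : 'I_n) (f : n.-tuple Z -> S) :=
  forall t t' : n.-tuple Z,
    (forall i, (tnth t i).1 = (tnth t' i).1) ->
    (forall i, i != j -> (tnth t i).2 = (tnth t' i).2) -> f t = f t'.

Lemma tnth_tconsS n (u : Z) (t : n.-tuple Z) i :
  tnth (tcons (u, t)) (lift ord0 i) = tnth t i.
Proof. exact: tnthS. Qed.

Lemma measurable_tconsl n (t : n.-tuple Z) :
  measurable_fun [set: Z] (fun u => tcons (u, t)).
Proof. exact: measurableT_comp (@measurable_tcons _ _ n) (measurable_pair2 t). Qed.

Lemma measurable_tconsr n (u : Z) :
  measurable_fun [set: n.-tuple Z] (fun t => tcons (u, t)).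
Proof. exact: measurableT_comp (@measurable_tcons _ _ n) (measurable_pair1 u). Qed.

Lemma measurable_response n (j : 'I_n) z :
  measurable_fun [set: n.-tuple Z] (fun t => indicator_le (tnth t j).2 z).
Proof.
exact: measurableT_comp (measurable_indicator_le z) (Defs.measurable_tnth j).
Qed.

Lemma measurable_covariate n (j : 'I_n) :
  measurable_fun [set: n.-tuple Z] (fun t => (tnth t j).1).
Proof. exact: measurableT_comp measurable_fst (Defs.measurable_tnth j). Qed.

Lemma measurable_cond_cdf_covariate n (j : 'I_n) z :
  measurable_fun [set: n.-tuple Z] (fun t => F (tnth t j).1 z).
Proof. exact: measurableT_comp (measurable_cond_cdfl K z) (measurable_covariate j). Qed.

(** Induction on the sample size. If [j] is not the first entry, that entry is frozen; if it is, it
    is integrated innermost with the rest frozen, and [f] becomes a function of its covariate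
    alone. *)
Lemma ge0_integral_response n (j : 'I_n) z (f : n.-tuple Z -> \bar R) :
  measurable_fun setT f -> (forall t, 0 <= f t)%E -> free_of_response j f ->
  (\int[tuple_power P n]_t (f t * (indicator_le (tnth t j).2 z)%:E) =
   \int[tuple_power P n]_t (f t * (F (tnth t j).1 z)%:E))%E.
Proof.
elim: n j f => [[]//|n IH] j f mf f0 fj.
have m1 : measurable_fun setT
    (fun t : n.+1.-tuple Z => f t * (indicator_le (tnth t j).2 z)%:E)%E.
  apply: emeasurable_funM => //; apply/measurable_EFinP.
  exact: measurable_response.
have m2 : measurable_fun setT
    (fun t : n.+1.-tuple Z => f t * (F (tnth t j).1 z)%:E)%E.
  apply: emeasurable_funM => //; apply/measurable_EFinP.
  exact: measurable_cond_cdf_covariate.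
have p1 (t : n.+1.-tuple Z) : (0 <= f t * (indicator_le (tnth t j).2 z)%:E)%E.
  by rewrite mule_ge0// lee_fin /indicator_le.
have p2 (t : n.+1.-tuple Z) : (0 <= f t * (F (tnth t j).1 z)%:E)%E.
  by rewrite mule_ge0// lee_fin cond_cdf_ge0.
case: (unliftP ord0 j) fj m1 m2 p1 p2 => [j' ->|->] fj m1 m2 p1 p2.
  rewrite [LHS](ge0_integral_tuple_powerS P m1 p1).
  rewrite [RHS](ge0_integral_tuple_powerS P m2 p2).
  apply: eq_integral => u _.
  under eq_integral do rewrite tnth_tconsS.
  under [RHS]eq_integral do rewrite tnth_tconsS.
  apply: (IH j' (fun t => f (tcons (u, t)))) => //.
    exact: measurableT_comp mf (measurable_tconsr u).
  move=> t t' tt1 tt2; apply: fj => i.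
    by case: (unliftP ord0 i) => [i'|] ->; rewrite ?tnth_tconsS.
  case: (unliftP ord0 i) => [i'|] -> //; rewrite !tnth_tconsS.
  rewrite (inj_eq (@lift_inj _ ord0)).
  exact: tt2.
rewrite [LHS](ge0_integral_tuple_powerSr P m1 p1).
rewrite [RHS](ge0_integral_tuple_powerSr P m2 p2).
apply: eq_integral => t _.
(* The first response is replaced by the placeholder 0, which exhibits [f] as a function of the
   covariate. *)
have fE (u : Z) : f (tcons (u, t)) = f (tcons ((u.1, 0 : R) : Z, t)).
  apply: fj => i; first by case: (unliftP ord0 i) => [i'|] ->; rewrite ?tnth_tconsS.
  by case: (unliftP ord0 i) => [i'|] -> //; rewrite !tnth_tconsS.
under eq_integral do rewrite fE.
under [RHS]eq_integral do rewrite fE.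
apply: (integral_cond_cdf PK z (f := fun x => f (tcons ((x, 0 : R) : Z, t)))) => //.
apply: measurableT_comp mf _; apply: measurableT_comp (measurable_tconsl t) _.
exact: measurable_pair2.
Qed.

Lemma bounded_integrable n (f : n.-tuple Z -> R) (c : R) :
  measurable_fun setT f -> (forall t, `|f t| <= c) ->
  (tuple_power P n).-integrable setT (EFin \o f).
Proof.
move=> mf fc; apply: measurable_bounded_integrable => //.
  by rewrite [X in (X < _)%E](tuple_power_setT P n) ltry.
exists c; split; first exact: num_real.
by move=> x cx t _; apply: le_trans (fc t) (ltW cx).
Qed.

Lemma indicator_le_itv (y z : R) : 0 <= indicator_le y z <= 1.
Proof. by rewrite /indicator_le; case: (y <= z); rewrite /= ?lexx ?ler01. Qed.

(** Signed form of the replacement of a response by its conditional mean; boundedness makes the two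
    integrals finite, so that they can be subtracted. *)
Lemma integral_response_orthogonal n (j : 'I_n) z (f : n.-tuple Z -> R) (c : R) :
  measurable_fun setT f -> (forall t, `|f t| <= c) -> free_of_response j f ->
  (\int[tuple_power P n]_t
     (f t * (indicator_le (tnth t j).2 z - F (tnth t j).1 z))%:E = 0)%E.
Proof.
move=> mf fc fj.
pose e (t : n.-tuple Z) : R := indicator_le (tnth t j).2 z.
pose g (t : n.-tuple Z) : R := F (tnth t j).1 z.
have me : measurable_fun setT e by exact: measurable_response.
have mg : measurable_fun setT g by exact: measurable_cond_cdf_covariate.
have e1 t : `|e t| <= 1.
  by rewrite ger0_norm; have /andP[] := indicator_le_itv (tnth t j).2 z.
have g1 t : `|g t| <= 1 by rewrite ger0_norm ?cond_cdf_ge0// cond_cdf_le1.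
(* Nonnegative weights first: [f = (f + c) - c]. *)
have ge0_case (q : n.-tuple Z -> R) (b : R) : measurable_fun setT q ->
    (forall t, 0 <= q t <= b) -> free_of_response j q ->
    (\int[tuple_power P n]_t (q t * (e t - g t))%:E = 0)%E.
  move=> mq qb qj.
  have ie : (tuple_power P n).-integrable setT (EFin \o (fun t => q t * e t)).
    apply: (bounded_integrable (c := b)); first exact: measurable_funM.
    move=> t; have /andP[q0 qb'] := qb t; rewrite normrM (ger0_norm q0).
    by rewrite -[leRHS]mulr1 ler_pM.
  have ig : (tuple_power P n).-integrable setT (EFin \o (fun t => q t * g t)).
    apply: (bounded_integrable (c := b)); first exact: measurable_funM.
    move=> t; have /andP[q0 qb'] := qb t; rewrite normrM (ger0_norm q0).
    by rewrite -[leRHS]mulr1 ler_pM.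
  under eq_integral do rewrite mulrBr EFinB.
  rewrite integralB_EFin//.
  have := @ge0_integral_response n j z (EFin \o q).
  rewrite /= => ->.
  - rewrite subee//; exact: integrable_fin_num ig.
  - exact/measurable_EFinP.
  - by move=> t; rewrite lee_fin; case/andP: (qb t).
  - by move=> t t' h1 h2; congr EFin; exact: qj.
have c0 : 0 <= c.
  exact: le_trans (normr_ge0 _) (fc [tuple of nseq n ([tuple of nseq d 0], 0)]).
have fcb t : 0 <= f t + c <= c + c.
  by have := fc t; rewrite ler_norml => /andP[? ?]; apply/andP; split; lra.
have mfc : measurable_fun setT (fun t => f t + c) by exact: measurable_funD.
have eg1 t : `|e t - g t| <= 2.
  by apply: le_trans (ler_normB _ _) _; have := e1 t; have := g1 t; lra.
transitivity (\int[tuple_power P n]_t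
  (((f t + c) * (e t - g t))%:E - (c * (e t - g t))%:E))%E.
  by apply: eq_integral => t _; rewrite -EFinB; congr EFin; rewrite /e /g; ring.
rewrite integralB_EFin//.
- rewrite (ge0_case _ (c + c))//; last first.
    by move=> t t' h1 h2; congr (_ + _); exact: fj.
  rewrite (ge0_case (fun=> c) c) ?subee// => t.
  by rewrite c0 lexx.
- apply: (bounded_integrable (c := (c + c) * 2)).
    by apply: measurable_funM => //; exact: measurable_funB.
  move=> t; have /andP[h0 h1] := fcb t.
  by rewrite normrM (ger0_norm h0) ler_pM.
- apply: (bounded_integrable (c := c * 2)).
    by apply: measurable_funM => //; exact: measurable_funB.
  by move=> t; rewrite normrM (ger0_norm c0) ler_pM.
Qed.

End response_orthogonality.

(** * Weights of the k-NN predictor *)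

Section ranking.
Context {T : finType} (le : rel T).
Hypotheses (le_total : total le) (le_trans' : transitive le)
  (le_anti : antisymmetric le).
Let s := sort le (enum T).

Let le_refl : reflexive le.
Proof. by move=> x; have := le_total x x; rewrite orbb. Qed.

Let s_uniq : uniq s. Proof. by rewrite sort_uniq enum_uniq. Qed.

Let mem_s x : x \in s. Proof. by rewrite mem_sort mem_enum. Qed.

Let le_index x y : le x y = (index x s <= index y s)%N.
Proof.
have s_sorted : sorted le s by exact: sort_sorted.
have geq u v : (index u s <= index v s)%N -> le u v.
  exact: (sorted_leq_index le_trans' le_refl s_sorted).
apply/idP/idP => [xy|]; last exact: geq.
have [//|yx] := leqP (index x s) (index y s).
have xyE : x = y by apply: le_anti; rewrite xy geq// ltnW.
by rewrite xyE ltnn in yx.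
Qed.

(** In the sorted enumeration of a total order, the entries up to [x] are exactly the elements below
    [x], itself included; hence the count is compared with [k] by a large inequality. *)
Lemma mem_take_sort k x :
  (x \in take k s) = (#|[pred y | le y x]| <= k)%N.
Proof.
rewrite in_take//; congr (_ <= _)%N.
have ix : (index x s < size s)%N by rewrite index_mem.
rewrite -(size_takel ix) -(card_uniqP (take_uniq _ s_uniq)).
by apply: eq_card => y; rewrite !inE in_take// ltnS le_index.
Qed.

Lemma sum_sort_take (V : nmodType) (k : nat) (f : T -> V) (x0 : T) :
  (k <= #|T|)%N ->
  \sum_(i < k) f (nth x0 s i) = \sum_(x | (#|[pred y | le y x]| <= k)%N) f x.
Proof.
move=> kT; have sk : size (take k s) = k by rewrite size_takel// size_sort -cardE.
rewrite -(big_mkord xpredT (fun i => f (nth x0 s i))).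
transitivity (\sum_(x <- take k s) f x).
  rewrite (big_nth x0) sk !big_mkord; apply: eq_bigr => i _.
  by rewrite nth_take.
rewrite big_uniq/=; last exact: take_uniq.
by apply: eq_bigl => x; rewrite mem_take_sort.
Qed.

End ranking.

Section knn_weights.
Context {R : realType} {d : nat}.
Local Notation X := (d.-tuple R).
Local Notation Z := (X * R)%type.
Variables (n k : nat) (s : 'S_n).
Hypothesis kn : (0 < k <= n)%N.

Lemma nn_le_total (t : n.-tuple Z) (x : X) : total (nn_le t s x).
Proof.
move=> i j; rewrite /nn_le; case: ltgtP => //= _.
exact: leq_total.
Qed.

Lemma nn_le_trans (t : n.-tuple Z) (x : X) : transitive (nn_le t s x).
Proof.
move=> j i l; rewrite /nn_le.
move=> /orP[ij|/andP[/eqP -> ij]] /orP[jl|/andP[/eqP <- jl]].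
- by rewrite (lt_trans ij jl).
- by rewrite ij.
- by rewrite jl.
- by rewrite eqxx (leq_trans ij jl) orbT.
Qed.

Lemma nn_le_anti (t : n.-tuple Z) (x : X) : antisymmetric (nn_le t s x).
Proof.
move=> i j; rewrite /nn_le; case: ltgtP => //= _ /anti_leq/val_inj.
exact: perm_inj.
Qed.

(** Counts the points ranked up to [j], itself included. Unlike the sorted list, this is visibly
    measurable and blind to the responses. *)
Definition knn_weight (t : n.-tuple Z) (x : X) (j : 'I_n) : bool :=
  (#|[pred i | nn_le t s x i j]| <= k)%N.

Lemma knn_weightE (t : n.-tuple Z) (x : X) z :
  knn k t s x z = k%:R^-1 *
    \sum_(j < n) (knn_weight t x j)%:R * indicator_le (tnth t j).2 z.
Proof.
have /andP[k0 kn'] := kn; have n0 : (0 < n)%N := leq_trans k0 kn'.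
rewrite /knn; congr (_ * _).
have := @sum_sort_take _ _ (nn_le_total t x) (@nn_le_trans t x)
  (@nn_le_anti t x) _ k (fun j => indicator_le (tnth t j).2 z) (Ordinal n0).
rewrite card_ord => /(_ kn') sumE.
rewrite [RHS](_ : _ = \sum_(j | knn_weight t x j) indicator_le (tnth t j).2 z).
  rewrite -sumE; apply: eq_bigr => i _.
  (* Since i < k <= n, the default value 0 of [nth] in the predictor is never read. *)
  rewrite /nn_responses (nth_map (Ordinal n0))// size_sort size_enum_ord.
  exact: leq_trans (ltn_ord i) kn'.
rewrite [RHS]big_mkcond/=; apply: eq_bigr => j _.
by case: ifP => _; rewrite ?mul1r ?mul0r.
Qed.

Lemma sum_knn_weight (t : n.-tuple Z) (x : X) :
  \sum_(j < n) (knn_weight t x j)%:R = k%:R :> R.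
Proof.
have /andP[k0 kn'] := kn; have n0 : (0 < n)%N := leq_trans k0 kn'.
have := @sum_sort_take _ _ (nn_le_total t x) (@nn_le_trans t x)
  (@nn_le_anti t x) _ k (fun j => 1 : R) (Ordinal n0).
rewrite card_ord => /(_ kn').
rewrite sumr_const card_ord => ->.
rewrite [RHS]big_mkcond/=; apply: eq_bigr => j _.
by rewrite /knn_weight; case: ifP.
Qed.

Lemma measurable_knn_weight d' (U : measurableType d')
    (t : U -> n.-tuple Z) (x : U -> X) j :
  measurable_fun setT t -> measurable_fun setT x ->
  measurable_fun [set: U] (fun u => (knn_weight (t u) (x u) j)%:R : R).
Proof.
move=> mt mx; apply: measurable_natr_bool.
have mdist i : measurable_fun [set: U] (fun u => eucl_dist (tnth (t u) i).1 (x u)).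
  apply: measurable_eucl_dist => //.
  exact: measurableT_comp (measurable_covariate i) mt.
have mle i : measurable_fun [set: U] (fun u => nn_le (t u) s (x u) i j).
  rewrite /nn_le; apply: measurable_or; first exact: measurable_fun_ltr.
  apply: measurable_and; last exact: measurable_cst.
  exact: measurable_fun_eqr.
rewrite (_ : (fun _ => _) = (fun u =>
    \sum_(i < n) (nn_le (t u) s (x u) i j)%:R <= k%:R :> R)).
  apply: measurable_fun_ler; last exact: measurable_cst.
  by apply: measurable_sum => i; exact: measurable_natr_bool.
apply/funext => u; rewrite /knn_weight -(ler_nat R); congr (_ <= _).
rewrite -sum1_card natr_sum [LHS]big_mkcond/=; apply: eq_bigr => i _.
by rewrite inE; case: ifP.
Qed.

Lemma knn_weight_covariate (t t' : n.-tuple Z) (x : X) :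
  (forall i, (tnth t i).1 = (tnth t' i).1) ->
  knn_weight t x =1 knn_weight t' x.
Proof.
move=> tt j; rewrite /knn_weight; congr (_ <= _)%N; apply: eq_card => i.
by rewrite !inE /nn_le !tt.
Qed.

(** If [j] were strictly farther than the radius, the at least [k] sample points within the radius
    would precede it whatever the tie-breaking; with [j] itself, its rank would exceed [k]. *)
Lemma knn_weight_radius (t : n.-tuple Z) (x : X) y j :
  knn_weight t x j ->
  eucl_dist (tnth t j).1 x <= sample_radius k (@ord0 n) (tcons ((x, y), t)).
Proof.
have /andP[k0 kn'] := kn.
move=> wj; rewrite leNgt; apply/negP => rj.
set T := tcons ((x, y), t) in rj.
have := @card_le_knn_radius R d n.+1 k (fun i => (tnth T i).1) ord0 kn'.
rewrite ltnNge => /negP; apply.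
(* Entry 0 is the test point, at distance 0 from itself; it is set aside to leave the sample
   points. *)
rewrite (cardD1 ord0) inE eucl_distxx.
have -> : 0 <= knn_radius k (fun i => (tnth T i).1) ord0.
  exact: (sample_radius_ge0 kn).
rewrite add1n; apply: leq_trans wj.
set A := [predD1 _ & _]; set B := [pred i | _ ].
have <- : #|[seq lift ord0 i | i in [pred i : 'I_n | lift ord0 i \in A]]| = #|A|.
  apply: eq_card => i; apply/mapP/idP => [[i' +] ->|iA].
    by rewrite mem_enum.
  case: (unliftP ord0 i) iA => [i'|] -> iA; last by move: iA; rewrite !inE eqxx.
  by exists i' => //; rewrite mem_enum inE.
rewrite fintype.card_image//; last exact: lift_inj.
rewrite [X in (_ < X)%N](cardD1 j) inE.
rewrite {1}/nn_le eqxx leqnn orbT add1n ltnS.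
apply/subset_leq_card/fintype.subsetP => i; rewrite !inE /= tnth_tconsS => ir.
have lt_ij : eucl_dist (tnth t i).1 x < eucl_dist (tnth t j).1 x.
  exact: le_lt_trans ir rj.
rewrite /nn_le lt_ij andbT; apply/negP => /eqP ij.
by move: lt_ij; rewrite ij ltxx.
Qed.

End knn_weights.

(** * Bias and variance *)

Section weighted_square.
Context {R : realFieldType} {I : finType}.

(** Cauchy-Schwarz for total weight [k]: with B and Q the two weighted sums, the nonnegative sum of
    the w i (k b i - B)^2 equals k (k Q - B^2). *)
Lemma sqr_weighted_sum_le (w b : I -> R) (k : R) : 0 < k ->
  (forall i, 0 <= w i) -> \sum_i w i = k ->
  (\sum_i w i * b i) ^+ 2 <= k * \sum_i w i * b i ^+ 2.
Proof.
move=> k0 w0 wk; set B := \sum_i w i * b i; set Q := \sum_i w i * b i ^+ 2.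
have : 0 <= \sum_i w i * (k * b i - B) ^+ 2.
  by apply: sumr_ge0 => i _; rewrite mulr_ge0// sqr_ge0.
rewrite (_ : \sum_i _ = k * (k * Q - B ^+ 2)); first by rewrite pmulr_rge0// subr_ge0.
transitivity (\sum_i (k ^+ 2 * (w i * b i ^+ 2) + (- 2 * k * B) * (w i * b i) +
    B ^+ 2 * w i)).
  by apply: eq_bigr => i _; ring.
by rewrite !big_split/= -!mulr_sumr -/B -/Q wk; ring.
Qed.

(* [e i - f i] is the centred response of the [i]-th point; the last sum
   collects the terms that vanish in expectation. *)
Lemma sqr_weighted_sum_split (w e f b : I -> R) :
  (forall i, w i ^+ 2 = w i) -> (forall i, e i ^+ 2 = e i) ->
  (\sum_i w i * (e i - f i) + \sum_i w i * b i) ^+ 2 =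
  \sum_i w i * (f i * (1 - f i)) + (\sum_i w i * b i) ^+ 2 +
  \sum_i (w i * (1 - 2 * f i) + 2 * w i * (\sum_j w j * b j) +
          \sum_(j | j != i) w i * w j * (e j - f j)) * (e i - f i).
Proof.
move=> w2 e2; set G := \sum_i w i * (e i - f i); set B := \sum_i w i * b i.
(* Since e^2 = e and w^2 = w, a diagonal term is w f (1 - f) + w (1 - 2 f) (e - f): a Bernoulli
   variance plus a multiple of the centred response. *)
have G2 : G ^+ 2 = \sum_i (w i * (f i * (1 - f i)) +
    (w i * (1 - 2 * f i) + \sum_(j | j != i) w i * w j * (e j - f j)) * (e i - f i)).
  rewrite expr2 {1}/G mulr_suml; apply: eq_bigr => i _.
  rewrite /G (bigD1 i)//= mulrDr mulrDl addrA; congr (_ + _).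
    rewrite (_ : _ * _ = w i ^+ 2 * (e i ^+ 2 - 2 * e i * f i + f i ^+ 2)); last by ring.
    by rewrite w2 e2; ring.
  rewrite mulr_sumr mulr_suml; apply: eq_bigr => j _; ring.
rewrite sqrrD G2 big_split/=.
set V := \sum_i w i * (f i * (1 - f i)).
set U := \sum_i (_ + _) * _.
rewrite [X in _ = _ + X](_ : _ = U + 2 * B * G); first by ring.
by rewrite /U /G mulr_sumr -big_split/=; apply: eq_bigr => i _; ring.
Qed.

End weighted_square.

Section knn_variance.
Context {R : realType} {d : nat}.
Local Notation X := (d.-tuple R).
Local Notation Z := (X * R)%type.
Variables (P : probability Z R) (K : R.-pker X ~> R).
Hypothesis PK : is_cond_distr P K.
Local Notation F := (cond_cdf K).
Variables (n k : nat) (s : 'S_n).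
Hypothesis kn : (0 < k <= n)%N.

Let k_gt0 : 0 < k%:R :> R. Proof. by rewrite ltr0n; case/andP: kn. Qed.

Let W (t : n.-tuple Z) (x : X) (j : 'I_n) : R := (knn_weight k s t x j)%:R.

(** The variance of the predictor at [z] given the covariates, plus the Cauchy-Schwarz bound on its
    squared bias. *)
Definition knn_bound (t : n.-tuple Z) (x : X) (z : R) : R :=
  (k%:R^-1) ^+ 2 * (\sum_(j < n) W t x j *
     (F (tnth t j).1 z * (1 - F (tnth t j).1 z))) +
  k%:R^-1 * (\sum_(j < n) W t x j * (F (tnth t j).1 z - F x z) ^+ 2).

Let W_ge0 t x j : 0 <= W t x j. Proof. by []. Qed.

Let W_le1 t x j : `|W t x j| <= 1.
Proof. by rewrite /W; case: knn_weight; rewrite /= ?normr1 ?normr0. Qed.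

Let W_sqr t x j : W t x j ^+ 2 = W t x j.
Proof. by rewrite /W; case: knn_weight; rewrite /= ?expr1n// expr0n. Qed.

Let indicator_le_sqr (y z : R) : indicator_le y z ^+ 2 = indicator_le y z :> R.
Proof. by rewrite /indicator_le; case: (y <= z); rewrite /= ?expr1n// expr0n. Qed.

Let le_normrM (a b u v : R) : `|a| <= u -> `|b| <= v -> `|a * b| <= u * v.
Proof. by move=> au bv; rewrite normrM ler_pM. Qed.

Let norm_sum_le (I : finType) (A : pred I) (f : I -> R) (c : R) : 0 <= c ->
  (forall i, `|f i| <= c) -> `|\sum_(i | A i) f i| <= c *+ #|I|.
Proof.
move=> c0 fc; apply: le_trans (ler_norm_sum _ _ _) _.
rewrite -sumr_const big_mkcond/=; apply: ler_sum => i _.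
by case: ifP.
Qed.

Lemma integral_sqr_knn_error_le x z :
  (\int[tuple_power P n]_t ((knn k t s x z - F x z) ^+ 2)%:E <=
   \int[tuple_power P n]_t (knn_bound t x z)%:E)%E.
Proof.
pose e (t : n.-tuple Z) j : R := indicator_le (tnth t j).2 z.
pose f (t : n.-tuple Z) j : R := F (tnth t j).1 z.
pose b (t : n.-tuple Z) j : R := f t j - F x z.
pose B (t : n.-tuple Z) : R := \sum_(j < n) W t x j * b t j.
pose S (t : n.-tuple Z) : R := (k%:R^-1) ^+ 2 *
  (\sum_(j < n) W t x j * (f t j * (1 - f t j)) + B t ^+ 2).
(* The coefficient of the [j]-th centred response. It involves the other responses, but not the
   [j]-th, as its last sum skips l = j. *)
pose phi j (t : n.-tuple Z) : R := W t x j * (1 - 2 * f t j) + 2 * W t x j * B t +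
  \sum_(l < n | l != j) W t x j * W t x l * (e t l - f t l).
have f01 t j : 0 <= f t j <= 1 by rewrite cond_cdf_ge0 cond_cdf_le1.
have Fx01 : 0 <= F x z <= 1 by rewrite cond_cdf_ge0 cond_cdf_le1.
have e01 t j : 0 <= e t j <= 1 by exact: indicator_le_itv.
have g1 t j : `|e t j - f t j| <= 1.
  by rewrite ler_norml; have := e01 t j; have := f01 t j; lra.
have b1 t j : `|b t j| <= 1.
  by rewrite ler_norml /b; have := f01 t j; lra.
have mW j : measurable_fun [set: n.-tuple Z] (fun t => W t x j).
  exact: (@measurable_knn_weight R d n k s _ _ (fun t => t) (fun=> x) j).
have me j : measurable_fun [set: n.-tuple Z] (fun t => e t j).
  exact: measurable_response.
have mf j : measurable_fun [set: n.-tuple Z] (fun t => f t j).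
  exact: measurable_cond_cdf_covariate.
have mb j : measurable_fun [set: n.-tuple Z] (fun t => b t j).
  exact: measurable_funB.
have mB : measurable_fun [set: n.-tuple Z] B.
  by apply: measurable_sum => j; exact: measurable_funM.
have mg j : measurable_fun [set: n.-tuple Z] (fun t => e t j - f t j).
  exact: measurable_funB.
have mf1 j : measurable_fun [set: n.-tuple Z] (fun t => f t j * (1 - f t j)).
  by apply: measurable_funM => //; exact: measurable_funB.
have mS : measurable_fun [set: n.-tuple Z] S.
  apply: measurable_funM => //; apply: measurable_funD.
    by apply: measurable_sum => j; exact: measurable_funM.
  exact: measurable_funX.
have mphi j : measurable_fun [set: n.-tuple Z] (phi j).
  apply: measurable_funD.
    apply: measurable_funD; last first.
      by apply: measurable_funM => //; exact: measurable_funM.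
    apply: measurable_funM => //; apply: measurable_funB => //.
    exact: measurable_funM.
  under eq_fun do rewrite big_mkcond/=.
  apply: measurable_sum => l; case: (l != j) => //.
  by apply: measurable_funM => //; exact: measurable_funM.
have B_le t : `|B t| <= n%:R.
  rewrite -[n in leRHS]card_ord; apply: norm_sum_le => // j.
  by rewrite -[leRHS]mulr1; apply: le_normrM.
(* A crude bound on the three summands of [phi], which serves integrability. *)
pose c : R := 1 + 2 * n%:R + n%:R.
have phi_le j t : `|phi j t| <= c.
  apply: le_trans (ler_normD _ _) _; apply: lerD.
    apply: le_trans (ler_normD _ _) _; apply: lerD.
      rewrite -[leRHS]mulr1; apply: le_normrM => //.
      by rewrite ler_norml; have := f01 t j; lra.
    apply: le_normrM => //; rewrite -[leRHS]mulr1.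
    by apply: le_normrM => //; rewrite ger0_norm.
  rewrite -[n in leRHS]card_ord; apply: norm_sum_le => // l.
  rewrite -[leRHS]mulr1; apply: le_normrM => //.
  by rewrite -[leRHS]mulr1; apply: le_normrM.
have phi_free j : free_of_response j (phi j).
  move=> t t' tt1 tt2.
  have WE l : W t x l = W t' x l by rewrite /W (knn_weight_covariate k s x tt1).
  have fE l : f t l = f t' l by rewrite /f tt1.
  have BE : B t = B t'.
    by apply: eq_bigr => l _; rewrite WE /b fE.
  rewrite /phi WE fE BE; congr (_ + _); apply: eq_bigr => l lj.
  by rewrite !WE fE /e tt2.
have splitE t : (knn k t s x z - F x z) ^+ 2 =
    S t + \sum_(j < n) (k%:R^-1) ^+ 2 * (phi j t * (e t j - f t j)).
  have -> : knn k t s x z - F x z =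
      k%:R^-1 * (\sum_(j < n) W t x j * (e t j - f t j) + B t).
    (* As the weights add up to [k], the target value can be distributed over the neighbours. *)
    have FE : F x z = k%:R^-1 * (k%:R * F x z) by rewrite mulKf// gt_eqF.
    rewrite (knn_weightE s kn) [X in _ - X]FE -mulrBr; congr (_ * _).
    rewrite -(sum_knn_weight s kn t x) mulr_suml -sumrB -big_split/=.
    by apply: eq_bigr => j _; rewrite /W /b /e /f; ring.
  rewrite exprMn sqr_weighted_sum_split//; last by move=> j; exact: indicator_le_sqr.
  by rewrite mulrDr mulr_sumr.
under eq_integral do rewrite splitE EFinD -sumEFin.
have iphi j : (tuple_power P n).-integrable setT
    (EFin \o (fun t => (k%:R^-1) ^+ 2 * (phi j t * (e t j - f t j)))).
  apply: (bounded_integrable P (c := (k%:R^-1) ^+ 2 * (c * 1))).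
    by apply: measurable_funM => //; exact: measurable_funM.
  move=> t; apply: le_normrM; first by rewrite ger0_norm// sqr_ge0.
  exact: le_normrM.
have iS : (tuple_power P n).-integrable setT (EFin \o S).
  apply: (bounded_integrable P
    (c := (k%:R^-1) ^+ 2 * (n%:R + n%:R * n%:R))) => // t.
  apply: le_normrM; first by rewrite ger0_norm// sqr_ge0.
  apply: le_trans (ler_normD _ _) _; apply: lerD; last first.
    by rewrite expr2; exact: le_normrM.
  rewrite -[n in leRHS]card_ord; apply: norm_sum_le => // j.
  rewrite -[leRHS]mulr1; apply: le_normrM => //.
  rewrite -[leRHS]mulr1; apply: le_normrM.
    by rewrite ger0_norm; case/andP: (f01 t j).
  by rewrite ler_norml; have := f01 t j; lra.
rewrite integralD//; last first.
  by apply: integrable_sum => // j _; exact: iphi.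
rewrite (integral_sum measurableT iphi) big1 ?adde0; last first.
  move=> j _; under eq_integral do rewrite /= mulrA.
  apply: (@integral_response_orthogonal R d P K PK n j z
    (fun t => k%:R^-1 ^+ 2 * phi j t) (k%:R^-1 ^+ 2 * c)).
  - exact: measurable_funM.
  - by move=> t; apply: le_normrM => //; rewrite ger0_norm// sqr_ge0.
  - by move=> t t' h1 h2; congr (_ * _); exact: phi_free.
apply: ge0_le_integral => //.
- move=> t _; rewrite lee_fin /S mulr_ge0 ?sqr_ge0// addr_ge0 ?sqr_ge0//.
  apply: sumr_ge0 => j _; rewrite !mulr_ge0//; have := f01 t j; lra.
- exact/measurable_EFinP.
- apply/measurable_EFinP; apply: measurable_funD; apply: measurable_funM => //.
    by apply: measurable_sum => j; exact: (measurable_funM (mW j) (mf1 j)).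
  apply: measurable_sum => j.
  exact: (measurable_funM (mW j) (measurable_funX 2 (mb j))).
move=> t _; rewrite lee_fin /S /knn_bound mulrDr lerD2l.
(* The factor [k] lost here turns the prefactor k^-2 of the squared bias into k^-1. *)
have := sqr_weighted_sum_le (b t) k_gt0 (W_ge0 t x) (sum_knn_weight s kn t x).
rewrite -/(B t) => Bk.
rewrite expr2 -mulrA ler_pM2l ?invr_gt0// ler_pdivrMl//.
Qed.

End knn_variance.

(** * Decomposition of the risk *)

Section risk_decomposition.
Context {R : realType} {d : nat}.
Local Notation X := (d.-tuple R).
Local Notation Z := (X * R)%type.
Local Notation mu := (@lebesgue_measure R).
Variables (P : probability Z R) (K : R.-pker X ~> R).
Hypothesis PK : is_cond_distr P K.
Local Notation F := (cond_cdf K).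
Local Open Scope ereal_scope.

(** Adding the cross term 2 f F to both sides leaves only integrals of nonnegative functions to
    compare, via [L] and [N]; the cross term is at most 2, hence has a finite integral and cancels
    at the end. *)
Lemma integral_sqr_error_split (f : X -> R) z :
  measurable_fun setT f -> (forall x, 0 <= f x <= 1)%R ->
  \int[P]_u ((f u.1 - indicator_le u.2 z) ^+ 2)%:E =
  \int[P]_u ((f u.1 - F u.1 z) ^+ 2 + F u.1 z * (1 - F u.1 z))%:E.
Proof.
move=> mf f01.
have f0 x : (0 <= f x)%R by case/andP: (f01 x).
have f1 x : (f x <= 1)%R by case/andP: (f01 x).
have F0 x : (0 <= F x z)%R := cond_cdf_ge0 K x z.
have F1 x : (F x z <= 1)%R := cond_cdf_le1 K x z.
have mf' : measurable_fun [set: Z] (fun u => f u.1).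
  exact: measurableT_comp mf measurable_fst.
have mF : measurable_fun [set: Z] (fun u => F u.1 z).
  exact: measurableT_comp (measurable_cond_cdfl K z) measurable_fst.
have me : measurable_fun [set: Z] (fun u => indicator_le u.2 z).
  exact: measurable_indicator_le.
have e0 u : (0 <= indicator_le u z :> R)%R by case/andP: (indicator_le_itv u z).
have e1 u : (indicator_le u z <= 1 :> R)%R by case/andP: (indicator_le_itv u z).
pose I (g : Z -> R) := \int[P]_u (g u)%:E.
have IE : I (fun u => indicator_le u.2 z) = I (fun u => F u.1 z).
  have := integral_cond_cdf PK z (f := fun=> 1) (measurable_cst _) (fun=> lee01).
  by under eq_integral do rewrite mul1e; under [RHS]eq_integral do rewrite mul1e.
have I2 : I (fun u => 2 * f u.1 * indicator_le u.2 z)%R =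
    I (fun u => 2 * f u.1 * F u.1 z)%R.
  have := integral_cond_cdf PK z (f := fun x => (2 * f x)%:E).
  by apply => [|x]; [exact/measurable_EFinP/measurable_funM|rewrite lee_fin mulr_ge0].
have mfF : measurable_fun [set: Z] (fun u => 2 * f u.1 * F u.1 z)%R.
  by apply: measurable_funM => //; exact: measurable_funM.
have mfe : measurable_fun [set: Z] (fun u => 2 * f u.1 * indicator_le u.2 z)%R.
  by apply: measurable_funM => //; exact: measurable_funM.
have Ifin : I (fun u => 2 * f u.1 * F u.1 z)%R \is a fin_num.
  rewrite ge0_fin_numE; last first.
    by apply: integral_ge0 => u _; rewrite lee_fin !mulr_ge0.
  apply: (@le_lt_trans _ _ (\int[P]_u (cst 2%:E) u)).
    apply: ge0_le_integral => //.
    - by move=> u _; rewrite lee_fin !mulr_ge0.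
    - exact/measurable_EFinP.
    - move=> u _; rewrite lee_fin; have := F0 u.1; have := F1 u.1.
      have := f0 u.1; have := f1 u.1; move: (f u.1) (F u.1 z) => a b; nra.
  by rewrite integral_cst// [X in _ * X](@probability_setT _ _ _ P) mule1 ltry.
have ID (g1 g2 : Z -> R) : measurable_fun setT g1 -> measurable_fun setT g2 ->
    (forall u, 0 <= g1 u)%R -> (forall u, 0 <= g2 u)%R ->
    I (fun u => g1 u + g2 u)%R = I g1 + I g2.
  move=> m1 m2 g1_0 g2_0; rewrite /I -ge0_integralD//.
  - by move=> u _; rewrite lee_fin.
  - exact/measurable_EFinP.
  - by move=> u _; rewrite lee_fin.
  - exact/measurable_EFinP.
have mf2 : measurable_fun [set: Z] (fun u => f u.1 ^+ 2)%R by exact: measurable_funX.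
have L : I (fun u => (f u.1 - indicator_le u.2 z) ^+ 2)%R +
    I (fun u => 2 * f u.1 * indicator_le u.2 z)%R =
    I (fun u => f u.1 ^+ 2)%R + I (fun u => indicator_le u.2 z).
  rewrite -!ID//.
  - apply: eq_integral => u _; congr EFin.
    rewrite sqrrB /indicator_le; case: (u.2 <= z)%R; rewrite /=; ring.
  - by move=> u; exact: sqr_ge0.
  - by apply: measurable_funX; exact: measurable_funB.
  - by move=> u; exact: sqr_ge0.
  - by move=> u; rewrite !mulr_ge0.
have N : I (fun u => (f u.1 - F u.1 z) ^+ 2 + F u.1 z * (1 - F u.1 z))%R +
    I (fun u => 2 * f u.1 * F u.1 z)%R =
    I (fun u => f u.1 ^+ 2)%R + I (fun u => F u.1 z).
  rewrite -!ID//.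
  - by apply: eq_integral => u _; congr EFin; ring.
  - by move=> u; exact: sqr_ge0.
  - apply: measurable_funD.
      by apply: measurable_funX; exact: measurable_funB.
    by apply: measurable_funM => //; exact: measurable_funB.
  - by move=> u; rewrite addr_ge0 ?sqr_ge0// mulr_ge0// subr_ge0.
  - by move=> u; rewrite !mulr_ge0.
have LN : I (fun u => (f u.1 - indicator_le u.2 z) ^+ 2)%R +
      I (fun u => 2 * f u.1 * F u.1 z)%R =
    I (fun u => (f u.1 - F u.1 z) ^+ 2 + F u.1 z * (1 - F u.1 z))%R +
      I (fun u => 2 * f u.1 * F u.1 z)%R.
  by rewrite -[in LHS]I2 L IE N.
have := congr1 (fun v => v - I (fun u => 2 * f u.1 * F u.1 z)%R) LN.
by rewrite !addeK.
Qed.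

Lemma measurable_sndR d' (U : measurableType d') :
  measurable_fun [set: U * measurableTypeR R] (fun p => p.2 : R).
Proof. exact: measurable_snd. Qed.

(** Stated as a sum, so that it is meaningful for infinite risks as well. *)
Lemma risk_split (f : X -> R -> R) :
  measurable_fun [set: X * R] (fun p => f p.1 p.2) ->
  (forall x z, 0 <= f x z <= 1)%R ->
  risk P f = risk P F + \int[P]_u \int[mu]_z ((f u.1 z - F u.1 z) ^+ 2)%:E.
Proof.
move=> mf f01.
have F0 x z : (0 <= F x z)%R := cond_cdf_ge0 K x z.
have F1 x z : (F x z <= 1)%R := cond_cdf_le1 K x z.
have mxz : measurable_fun [set: Z * measurableTypeR R] (fun p => (p.1.1, p.2 : R)).
  apply/measurable_fun_pairP; split; last exact: measurable_sndR.
  exact: measurableT_comp measurable_fst measurable_fst.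
have mF : measurable_fun [set: Z * measurableTypeR R] (fun p => F p.1.1 p.2).
  exact: (measurableT_comp (measurable_cond_cdf K) mxz).
have me : measurable_fun [set: Z * measurableTypeR R]
    (fun p => indicator_le p.1.2 p.2 : R).
  apply: measurable_natr_bool; apply: measurable_fun_ler; last exact: measurable_sndR.
  exact: measurableT_comp measurable_snd measurable_fst.
have mFF : measurable_fun [set: Z * measurableTypeR R]
    (fun p => F p.1.1 p.2 * (1 - F p.1.1 p.2))%R.
  by apply: measurable_funM => //; exact: measurable_funB.
have FF0 x z : (0 <= F x z * (1 - F x z))%R by rewrite mulr_ge0// subr_ge0.
have key (g : X -> R -> R) : measurable_fun [set: X * R] (fun p => g p.1 p.2) ->
    (forall x z, 0 <= g x z <= 1)%R ->
    risk P g = \int[P]_u \int[mu]_z ((g u.1 z - F u.1 z) ^+ 2)%:E +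
      \int[P]_u \int[mu]_z (F u.1 z * (1 - F u.1 z))%:E.
  move=> mg g01.
  have mg' : measurable_fun [set: Z * measurableTypeR R] (fun p => g p.1.1 p.2).
    exact: (measurableT_comp mg mxz).
  pose q1 (p : Z * measurableTypeR R) : \bar R :=
    ((g p.1.1 p.2 - indicator_le p.1.2 p.2) ^+ 2)%:E.
  pose q2 (p : Z * measurableTypeR R) : \bar R :=
    ((g p.1.1 p.2 - F p.1.1 p.2) ^+ 2)%:E.
  pose q3 (p : Z * measurableTypeR R) : \bar R :=
    (F p.1.1 p.2 * (1 - F p.1.1 p.2))%:E.
  have mq1 : measurable_fun setT q1.
    by apply/measurable_EFinP; apply: measurable_funX; exact: measurable_funB.
  have mq2 : measurable_fun setT q2.
    by apply/measurable_EFinP; apply: measurable_funX; exact: measurable_funB.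
  have mq3 : measurable_fun setT q3 by exact/measurable_EFinP.
  have q1_0 p : 0 <= q1 p by rewrite lee_fin sqr_ge0.
  have q2_0 p : 0 <= q2 p by rewrite lee_fin sqr_ge0.
  have q3_0 p : 0 <= q3 p by rewrite lee_fin.
  rewrite /risk /CRPS.
  rewrite [LHS](fubini_tonelli (m1 := P) (m2 := mu) q1 mq1 q1_0).
  rewrite [X in _ = X + _](fubini_tonelli (m1 := P) (m2 := mu) q2 mq2 q2_0).
  rewrite [X in _ = _ + X](fubini_tonelli (m1 := P) (m2 := mu) q3 mq3 q3_0).
  rewrite -ge0_integralD//; last 4 first.
  - by move=> z _; apply: integral_ge0.
  - exact: (measurable_fun_fubini_tonelli_G (m1 := P) q2 mq2 q2_0).
  - by move=> z _; apply: integral_ge0.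
  - exact: (measurable_fun_fubini_tonelli_G (m1 := P) q3 mq3 q3_0).
  apply: eq_integral => z _.
  rewrite -ge0_integralD//; last 2 first.
  - exact: (measurableT_comp mq2 (measurable_pair2 z)).
  - exact: (measurableT_comp mq3 (measurable_pair2 z)).
  rewrite /q1/=.
  apply: (integral_sqr_error_split (f := g ^~ z)) => //.
  exact: (measurableT_comp mg (measurable_pair2 z)).
have Ff01 x z : (0 <= F x z <= 1)%R by rewrite F0 F1.
(* For the predictor [F] the error vanishes, so [key] identifies the integral of F (1 - F) with the
   risk of [F]. *)
have FF : \int[P]_u \int[mu]_z ((F u.1 z - F u.1 z) ^+ 2)%:E = 0.
  by apply: integral0_eq => u _; apply: integral0_eq => z _; rewrite subrr expr0n.
have := key F (measurable_cond_cdf K) Ff01; rewrite FF add0e => ->.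
by rewrite (key f mf f01) [LHS]addeC.
Qed.

End risk_decomposition.

Section knn_risk_bound.
Context {R : realType} {d : nat}.
Local Notation X := (d.-tuple R).
Local Notation Z := (X * R)%type.
Local Notation mu := (@lebesgue_measure R).
Variables (P : probability Z R) (K : R.-pker X ~> R).
Hypothesis PK : is_cond_distr P K.
Local Notation F := (cond_cdf K).
Variables (n k : nat) (s : 'S_n).
Hypothesis kn : (0 < k <= n)%N.

Let k_gt0 : 0 < k%:R :> R. Proof. by rewrite ltr0n; case/andP: kn. Qed.

Section measurability.
Context {d' : measure_display} {U : measurableType d'}.
Variables (t : U -> n.-tuple Z) (x : U -> X) (z : U -> R).
Hypotheses (mt : measurable_fun setT t) (mx : measurable_fun setT x)
  (mz : measurable_fun setT z).

Let mtj j : measurable_fun [set: U] (fun u => tnth (t u) j).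
Proof. exact: measurableT_comp (Defs.measurable_tnth j) mt. Qed.

Lemma measurable_knn : measurable_fun [set: U] (fun u => knn k (t u) s (x u) (z u)).
Proof.
under eq_fun do rewrite (knn_weightE s kn).
apply: measurable_funM => //; apply: measurable_sum => j; apply: measurable_funM.
  exact: measurable_knn_weight.
apply: measurable_natr_bool; apply: measurable_fun_ler => //.
exact: measurableT_comp measurable_snd (mtj j).
Qed.

Lemma measurable_cond_cdf_comp (y : U -> X) :
  measurable_fun setT y -> measurable_fun [set: U] (fun u => F (y u) (z u)).
Proof.
move=> my; have myz : measurable_fun [set: U] (fun u => (y u, z u)).
  exact/measurable_fun_pairP.
exact: (measurableT_comp (measurable_cond_cdf K) myz).
Qed.

Lemma measurable_knn_bound :
  measurable_fun [set: U] (fun u => knn_bound K k s (t u) (x u) (z u)).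
Proof.
have mF j : measurable_fun [set: U] (fun u => F (tnth (t u) j).1 (z u)).
  apply: measurable_cond_cdf_comp.
  exact: measurableT_comp measurable_fst (mtj j).
have mw j : measurable_fun [set: U] (fun u => (knn_weight k s (t u) (x u) j)%:R : R).
  exact: measurable_knn_weight.
apply: measurable_funD; apply: measurable_funM => //; apply: measurable_sum => j;
  apply: measurable_funM => //.
  by apply: measurable_funM => //; exact: measurable_funB.
apply: measurable_funX; apply: measurable_funB => //.
exact: measurable_cond_cdf_comp.
Qed.

End measurability.

Lemma knn_itv (t : n.-tuple Z) x z : 0 <= knn k t s x z <= 1.
Proof.
rewrite (knn_weightE s kn) ler_pdivrMl// mulr1.
rewrite mulr_ge0 ?invr_ge0 ?(ltW k_gt0)//=; last first.
  by apply: sumr_ge0 => j _; rewrite mulr_ge0// /indicator_le.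
rewrite -(sum_knn_weight s kn t x); apply: ler_sum => j _.
by rewrite -[leRHS]mulr1 ler_wpM2l//; case/andP: (indicator_le_itv (tnth t j).2 z).
Qed.

Lemma knn_bound_ge0 (t : n.-tuple Z) x z : 0 <= knn_bound K k s t x z.
Proof.
rewrite /knn_bound addr_ge0// mulr_ge0 ?sqr_ge0 ?invr_ge0 ?(ltW k_gt0)//.
  apply: sumr_ge0 => j _; rewrite mulr_ge0// mulr_ge0 ?cond_cdf_ge0//.
  by rewrite subr_ge0 cond_cdf_le1.
by apply: sumr_ge0 => j _; rewrite mulr_ge0// sqr_ge0.
Qed.

Local Open Scope ereal_scope.

Let sqr_error (t : n.-tuple Z) (x : X) (z : R) : \bar R :=
  ((knn k t s x z - F x z) ^+ 2)%:E.

Let sqr_error_ge0 t x z : 0 <= sqr_error t x z.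
Proof. by rewrite lee_fin sqr_ge0. Qed.

Let measurable_sqr_error d' (U : measurableType d') (t : U -> n.-tuple Z)
    (x : U -> X) (z : U -> R) :
  measurable_fun setT t -> measurable_fun setT x -> measurable_fun setT z ->
  measurable_fun [set: U] (fun u => sqr_error (t u) (x u) (z u)).
Proof.
move=> mt mx mz; apply/measurable_EFinP; apply: measurable_funX.
by apply: measurable_funB; [exact: measurable_knn|exact: measurable_cond_cdf_comp].
Qed.

Lemma integral_knn_error_le x :
  \int[tuple_power P n]_t \int[mu]_z sqr_error t x z <=
  \int[tuple_power P n]_t \int[mu]_z (knn_bound K k s t x z)%:E.
Proof.
pose p1 (q : n.-tuple Z * measurableTypeR R) := sqr_error q.1 x q.2.
pose p2 (q : n.-tuple Z * measurableTypeR R) : \bar R :=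
  (knn_bound K k s q.1 x q.2)%:E.
have m1 : measurable_fun setT p1.
  by apply: measurable_sqr_error => //; exact: measurable_sndR.
have m2 : measurable_fun setT p2.
  apply/measurable_EFinP.
  by apply: measurable_knn_bound => //; exact: measurable_sndR.
have p1_0 q : 0 <= p1 q by exact: sqr_error_ge0.
have p2_0 q : 0 <= p2 q by rewrite lee_fin knn_bound_ge0.
rewrite [leLHS](fubini_tonelli (m1 := tuple_power P n) (m2 := mu) p1 m1 p1_0).
rewrite [leRHS](fubini_tonelli (m1 := tuple_power P n) (m2 := mu) p2 m2 p2_0).
apply: ge0_le_integral => //.
- by move=> z _; exact: integral_ge0.
- exact: (measurable_fun_fubini_tonelli_G (m1 := tuple_power P n) p1 m1 p1_0).
- exact: (measurable_fun_fubini_tonelli_G (m1 := tuple_power P n) p2 m2 p2_0).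
by move=> z _; exact: integral_sqr_knn_error_le.
Qed.

Lemma measurable_integral_knn_bound :
  measurable_fun [set: n.+1.-tuple Z] (fun T => \int[mu]_z
    (knn_bound K k s (tuncons T).2 (tuncons T).1.1 z)%:E).
Proof.
pose Gz (q : n.+1.-tuple Z * measurableTypeR R) : \bar R :=
  (knn_bound K k s (tuncons q.1).2 (tuncons q.1).1.1 q.2)%:E.
have mtu : measurable_fun [set: n.+1.-tuple Z * measurableTypeR R]
    (fun q => tuncons q.1 : Z * n.-tuple Z).
  exact: measurableT_comp (@measurable_tuncons _ Z n) measurable_fst.
have mGz : measurable_fun setT Gz.
  apply/measurable_EFinP; apply: measurable_knn_bound; last exact: measurable_sndR.
    exact: measurableT_comp measurable_snd mtu.
  apply: measurableT_comp measurable_fst _.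
  exact: measurableT_comp measurable_fst mtu.
have Gz0 q : 0 <= Gz q by rewrite lee_fin knn_bound_ge0.
exact: (measurable_fun_fubini_tonelli_F (m2 := mu) Gz mGz Gz0).
Qed.

(** Sample and test point are merged into a single tuple of n + 1 independent draws, the setting in
    which the moments of the radius were bounded. *)
Lemma integral_risk_knn_le :
  \int[tuple_power P n]_t risk P (knn k t s) <= risk P F +
  \int[tuple_power P n.+1]_T \int[mu]_z
    (knn_bound K k s (tuncons T).2 (tuncons T).1.1 z)%:E.
Proof.
pose Q (q : n.-tuple Z * Z) := \int[mu]_z sqr_error q.1 q.2.1 z.
pose Qz (q : n.-tuple Z * Z * measurableTypeR R) := sqr_error q.1.1 q.1.2.1 q.2.
have mQz : measurable_fun setT Qz.
  apply: measurable_sqr_error; last exact: measurable_sndR.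
    exact: measurableT_comp measurable_fst measurable_fst.
  apply: measurableT_comp measurable_fst _.
  exact: measurableT_comp measurable_snd measurable_fst.
have mQ : measurable_fun setT Q.
  exact: (measurable_fun_fubini_tonelli_F (m2 := mu) Qz mQz
    (fun=> sqr_error_ge0 _ _ _)).
have Q0 q : 0 <= Q q by exact: integral_ge0.
under eq_integral => t _.
  rewrite (risk_split PK (f := knn k t s)); last 2 first.
  - apply: measurable_knn; first exact: measurable_cst.
      exact: measurable_fst.
    exact: measurable_snd.
  - by move=> x z; exact: knn_itv.
  over.
rewrite ge0_integralD//; last 3 first.
- move=> t _; apply: integral_ge0 => u _; apply: integral_ge0 => z _.
  by rewrite lee_fin sqr_ge0.
- move=> t _; apply: integral_ge0 => u _; exact: (Q0 (t, u)).
- exact: (measurable_fun_fubini_tonelli_F (m2 := P) Q mQ Q0).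
rewrite integral_cst// [X in _ * X + _](tuple_power_setT P n) mule1 leeD2l//.
rewrite [leLHS](fubini_tonelli (m1 := tuple_power P n) (m2 := P) Q mQ Q0).
pose G (T : n.+1.-tuple Z) :=
  \int[mu]_z (knn_bound K k s (tuncons T).2 (tuncons T).1.1 z)%:E.
have mG : measurable_fun setT G.
  exact: measurable_integral_knn_bound.
have G0 T : 0 <= G T.
  by apply: integral_ge0 => z _; rewrite lee_fin knn_bound_ge0.
rewrite [leRHS](ge0_integral_tuple_powerS P mG G0).
apply: ge0_le_integral => //.
- by move=> u _; exact: integral_ge0.
- exact: (measurable_fun_fubini_tonelli_G (m1 := tuple_power P n) Q mQ Q0).
- have mGt : measurable_fun setT (G \o @tcons _ Z n).
    exact: measurableT_comp mG (@measurable_tcons _ Z n).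
  exact: (measurable_fun_fubini_tonelli_F (m2 := tuple_power P n) _ mGt (fun=> G0 _)).
move=> u _; apply: le_trans (integral_knn_error_le u.1) _.
rewrite le_eqVlt; apply/orP; left; apply/eqP; apply: eq_integral => t _.
by rewrite /G tconsK.
Qed.

End knn_risk_bound.

Section knn_rate.
Context {R : realType} {d : nat}.
Local Notation X := (d.-tuple R).
Local Notation Z := (X * R)%type.
Local Notation mu := (@lebesgue_measure R).
Variables (P : probability Z R) (K : R.-pker X ~> R).
Hypothesis PK : is_cond_distr P K.
Local Notation F := (cond_cdf K).
Variables (h C M : R).
Hypotheses (h0 : 0 < h) (C0 : 0 < C) (M0 : 0 < M).
Hypothesis P_cube : {ae P, forall u, unit_cube u.1}.
Hypothesis F_var : forall x, unit_cube x ->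
  (\int[mu]_z (F x z * (1 - F x z))%:E <= M%:E)%E.
Hypothesis F_holder : forall x x', unit_cube x -> unit_cube x' ->
  (Lnorm mu 2%:E (fun z => (F x' z - F x z)%:E) <= (C * eucl_dist x' x `^ h)%:E)%E.

Lemma integral_sqr_cond_cdf_le x x' : unit_cube x -> unit_cube x' ->
  (\int[mu]_z ((F x' z - F x z) ^+ 2)%:E <=
   (C ^+ 2 * eucl_dist x' x `^ (2 * h))%:E)%E.
Proof.
move=> cx cx'; have := F_holder cx cx'.
set N := Lnorm _ _ _ => N_le.
have N0 : (0 <= N)%E by exact: Lnorm_ge0.
have c0 : 0 <= C * eucl_dist x' x `^ h by rewrite mulr_ge0 ?powR_ge0// ltW.
have : (N `^ 2 <= (C * eucl_dist x' x `^ h)%:E `^ 2)%E.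
  by apply: gt0_ler_poweR => //; rewrite in_itv/= ?N0 ?lee_fin ?c0 ?leey.
rewrite /N poweR_Lnorm; last by rewrite pnatr_eq0.
rewrite poweR_EFin powR_mulrn// exprMn -(powR_mulrn 2 (powR_ge0 _ _)) -powRrM.
rewrite (mulrC h); apply: le_trans.
rewrite le_eqVlt; apply/orP; left; apply/eqP; apply: eq_integral => z _.
by rewrite poweR_EFin powR_mulrn// real_normK// num_real.
Qed.

Variables (n k : nat) (s : 'S_n).
Hypothesis kn : (0 < k <= n)%N.

Let k_gt0 : 0 < k%:R :> R. Proof. by rewrite ltr0n; case/andP: kn. Qed.

(** The total weight is [k], and each neighbour contributes at most [M] to the variance sum and C^2
    r ^ (2 h) to the bias sum; the prefactors are k^-2 and k^-1. *)
Lemma integral_knn_bound_le (x : X) (y : R) (t : n.-tuple Z) :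
  unit_cube x -> (forall j, unit_cube (tnth t j).1) ->
  (\int[mu]_z (knn_bound K k s t x z)%:E <=
   (M / k%:R + C ^+ 2 *
      sample_radius k (@ord0 n) (tcons ((x, y), t)) `^ (2 * h))%:E)%E.
Proof.
move=> cx ct; set r := sample_radius _ _ _.
pose W j : R := (knn_weight k s t x j)%:R.
have W0 j : 0 <= W j by [].
have mF x' : measurable_fun [set: measurableTypeR R] (fun z => F x' z).
  apply: (measurable_cond_cdf_comp K (z := fun z : measurableTypeR R => z : R)) => //.
pose V j z := F (tnth t j).1 z * (1 - F (tnth t j).1 z).
pose D j z := (F (tnth t j).1 z - F x z) ^+ 2.
have V0 j z : 0 <= V j z.
  by rewrite mulr_ge0 ?cond_cdf_ge0// subr_ge0 cond_cdf_le1.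
have D0 j z : 0 <= D j z by exact: sqr_ge0.
have mVr j : measurable_fun [set: measurableTypeR R] (V j).
  by apply: measurable_funM => //; exact: measurable_funB.
have mDr j : measurable_fun [set: measurableTypeR R] (D j).
  by apply: measurable_funX; exact: measurable_funB.
have mV j : measurable_fun [set: measurableTypeR R] (fun z => (V j z)%:E).
  exact/measurable_EFinP.
have mD j : measurable_fun [set: measurableTypeR R] (fun z => (D j z)%:E).
  exact/measurable_EFinP.
have sumW : \sum_j W j = k%:R by exact: sum_knn_weight.
(* Shared by both sums. The bound [A] is asked only at indices of nonzero weight, which for the bias
   are the points within the radius. *)
have int_sum (G : 'I_n -> measurableTypeR R -> R) (c : R) (A : R) :
    (forall j z, 0 <= G j z) -> 0 <= c -> 0 <= A ->
    (forall j, measurable_fun setT (fun z => (G j z)%:E)) ->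
    (forall j, knn_weight k s t x j -> (\int[mu]_z (G j z)%:E <= A%:E)%E) ->
    (\int[mu]_z (c * \sum_j W j * G j z)%:E <= (c * (k%:R * A))%:E)%E.
  move=> G0 c0 A0 mG GA.
  have mWG j : measurable_fun setT (fun z => ((W j)%:E * (G j z)%:E)%E).
    exact: measurable_funeM.
  have WG0 j z : (0 <= (W j)%:E * (G j z)%:E)%E by rewrite mule_ge0// lee_fin.
  under eq_integral do rewrite EFinM -sumEFin.
  rewrite ge0_integralZl//; last 2 first.
  - by apply: emeasurable_sum => j; exact: mWG.
  - by move=> z _; apply: sume_ge0 => j _; exact: WG0.
  rewrite EFinM; apply: lee_wpmul2l; first by rewrite lee_fin.
  rewrite (ge0_integral_sum mu measurableT mWG (fun j z _ => WG0 j z)).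
  rewrite -sumW mulr_suml -sumEFin; apply: lee_sum => j _.
  rewrite ge0_integralZl ?lee_fin//; last by move=> z _; rewrite lee_fin.
  rewrite EFinM /W; case: (boolP (knn_weight k s t x j)) => [wj|_].
    by rewrite !mul1e GA.
  by rewrite !mul0e.
have r0 : 0 <= r by exact: (sample_radius_ge0 kn).
have := int_sum V (k%:R^-1 ^+ 2) M V0 (sqr_ge0 _) (ltW M0) mV (fun j _ => F_var (ct j)).
have := int_sum D k%:R^-1 (C ^+ 2 * r `^ (2 * h)) D0.
rewrite invr_ge0 (ltW k_gt0) mulr_ge0 ?sqr_ge0 ?powR_ge0// => /(_ isT isT mD).
have -> : k%:R^-1 ^+ 2 * (k%:R * M) = M / k%:R by field; rewrite gt_eqF.
rewrite mulKf ?gt_eqF// => DA VA.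
rewrite /knn_bound; under eq_integral do rewrite EFinD.
rewrite ge0_integralD//; last 4 first.
- move=> z _; rewrite lee_fin mulr_ge0 ?sqr_ge0//; apply: sumr_ge0 => j _.
  by apply: mulr_ge0; [exact: W0|exact: V0].
- apply/measurable_EFinP; apply: measurable_funM => //; apply: measurable_sum => j.
  exact: (measurable_funM (measurable_cst (W j)) (mVr j)).
- move=> z _; rewrite lee_fin mulr_ge0 ?invr_ge0 ?(ltW k_gt0)//.
  by apply: sumr_ge0 => j _; apply: mulr_ge0; [exact: W0|exact: D0].
- apply/measurable_EFinP; apply: measurable_funM => //; apply: measurable_sum => j.
  exact: (measurable_funM (measurable_cst (W j)) (mDr j)).
rewrite EFinD; apply: leeD; first exact: VA.
apply: DA => j wj; apply: le_trans (integral_sqr_cond_cdf_le cx (ct j)) _.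
rewrite lee_fin ler_wpM2l ?sqr_ge0//.
have h2 : 0 <= 2 * h by rewrite mulr_ge0// ltW.
apply: (ge0_ler_powR h2); rewrite ?nnegrE ?eucl_dist_ge0//.
exact: (@knn_weight_radius R d n k s kn t x y j wj).
Qed.

Lemma knn_risk_le (rho : R) :
  (\int[tuple_power P n.+1]_T
     (sample_radius k (@ord0 n) T `^ (2 * h))%:E <= rho%:E)%E ->
  (\int[tuple_power P n]_t risk P (knn k t s) <=
   risk P F + (M / k%:R + C ^+ 2 * rho)%:E)%E.
Proof.
move=> r_rho; apply: le_trans (integral_risk_knn_le PK s kn) _; apply: leeD2l.
have mr : measurable_fun [set: n.+1.-tuple Z]
    (fun T => (sample_radius k (@ord0 n) T `^ (2 * h))%:E).
  apply/measurable_EFinP.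
  exact: (measurableT_comp (@measurable_powR R _) (measurable_sample_radius kn ord0)).
have r0 T : (0 <= (sample_radius k (@ord0 n) T `^ (2 * h))%:E)%E.
  by rewrite lee_fin powR_ge0.
have q0 T : (0 <= (C ^+ 2)%:E * (sample_radius k (@ord0 n) T `^ (2 * h))%:E)%E.
  by apply: mule_ge0 => //; rewrite lee_fin sqr_ge0.
have Mk0 : 0 <= M / k%:R by rewrite divr_ge0// ltW.
apply: (@le_trans _ _ (\int[tuple_power P n.+1]_T ((M / k%:R)%:E +
    (C ^+ 2)%:E * (sample_radius k (@ord0 n) T `^ (2 * h))%:E))%E).
  apply: ae_ge0_le_integral => //.
  - by move=> T _; apply: integral_ge0 => z _; rewrite lee_fin (knn_bound_ge0 K s kn).
  - exact: (measurable_integral_knn_bound K s kn).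
  - by move=> T _; apply: adde_ge0 => //; rewrite lee_fin.
  - by apply: emeasurable_funD => //; exact: measurable_funeM.
  have := tuple_power_ae n.+1 P_cube; apply: filterS => T T_cube _.
  have TE : T = tcons (((tuncons T).1.1, (tuncons T).1.2) : Z, (tuncons T).2).
    rewrite -surjective_pairing -surjective_pairing.
    by rewrite [LHS]tuple_eta.
  rewrite [in X in (_ <= X)%E]TE; apply: integral_knn_bound_le.
    exact: (T_cube ord0).
  move=> j; rewrite (_ : tnth _ j = tnth T (lift ord0 j)); first exact: T_cube.
  by rewrite [in RHS]TE tnth_tconsS.
rewrite ge0_integralD//; last exact: measurable_funeM.
rewrite integral_cst// [X in (_ * X + _)%E](tuple_power_setT P n.+1) mule1.
have C2 : (0 <= (C ^+ 2)%:E :> \bar R)%E by rewrite lee_fin sqr_ge0.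
rewrite EFinD leeD2l// ge0_integralZl//.
exact: (lee_wpmul2l C2 r_rho).
Qed.

End knn_rate.

(** * Rate of convergence *)

Section excess_risk.
Context {R : realType} {d : nat}.
Local Notation X := (d.-tuple R).
Local Notation Z := (X * R)%type.
Variable P : probability Z R.

(** The membership of [P] in the class comes with its own version [K] of the conditional law. Its
    risk is minimal, so an excess bound relative to [K] passes to [K0]. *)
Lemma risk_cond_cdf_le (K K0 : R.-pker X ~> R) : is_cond_distr P K ->
  (risk P (cond_cdf K) <= risk P (cond_cdf K0))%E.
Proof.
move=> PK; rewrite (risk_split PK (measurable_cond_cdf K0)); last first.
  by move=> x z; rewrite cond_cdf_ge0 cond_cdf_le1.
rewrite leeDl//; apply: integral_ge0 => u _; apply: integral_ge0 => z _.
by rewrite lee_fin sqr_ge0.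
Qed.

Lemma knn_excess_risk_le (K0 : R.-pker X ~> R) (h C M rho : R) (n k : nat) :
  0 < h -> 0 < C -> 0 < M -> holder_class h C M P -> (0 < k <= n)%N ->
  (\int[tuple_power P n.+1]_T
     (sample_radius k (@ord0 n) T `^ (2 * h))%:E <= rho%:E)%E ->
  (knn_expected_risk P n k - risk P (cond_cdf K0) <=
    (M / k%:R + C ^+ 2 * rho)%:E)%E.
Proof.
move=> h0 C0 M0 [K PK [P_cube F_var F_holder]] kn r_rho.
set b := M / _ + _.
(* The bound is the same for each of the n! rankings, hence holds for their average. *)
have risk_le : (knn_expected_risk P n k <= risk P (cond_cdf K) + b%:E)%E.
  apply: (@le_trans _ _ ((n`!%:R^-1)%:E *
      \sum_(s : 'S_n) (risk P (cond_cdf K) + b%:E))%E).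
    apply: lee_wpmul2l; first by rewrite lee_fin invr_ge0.
    apply: lee_sum => s _.
    exact: (knn_risk_le PK h0 C0 M0 P_cube F_var F_holder s kn r_rho).
  rewrite [X in (_ * X <= _)%E](_ : _ =
      n`!%:R%:E * (risk P (cond_cdf K) + b%:E))%E; last first.
    rewrite mule_natl sumr_const; congr (_ *+ _); exact: card_Sn.
  rewrite muleA -EFinM mulVf ?mul1e//.
have := risk_cond_cdf_le K0 PK.
have : (0 <= risk P (cond_cdf K))%E.
  apply: integral_ge0 => u _; apply: integral_ge0 => z _.
  by rewrite lee_fin sqr_ge0.
move: risk_le; case: (risk P (cond_cdf K0)) => [r0| |].
- case: (risk P (cond_cdf K)) => [r| |]//; rewrite ?leye_eq ?lee_fin//.
  move=> + _ rr0 => /(leeD2r (- r0%:E)%E) /le_trans; apply.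
  rewrite lee_fin; lra.
(* Subtracting an infinite risk gives -oo, below any bound. *)
- by move=> _ _ _; rewrite addeNy leNye.
- by move=> _ + + => /le_trans /[apply].
Qed.

End excess_risk.

Theorem corollary1 (R : realType) (d : nat) (h C M : R)
    (P : probability (d.-tuple R * R)%type R)
    (K : R.-pker (d.-tuple R) ~> R) :
  (1 <= d)%N -> 0 < h <= 1 -> 0 < C -> 0 < M ->
  is_cond_distr P K -> holder_class h C M P ->
  (d = 1%N -> forall n k : nat, (1 <= k <= n)%N ->
     k%:R = (M / (h * C ^+ 2 * 8 `^ h)) `^ (1 / (h + 1))
              * n%:R `^ (h / (h + 1)) ->
     (knn_expected_risk P n k - risk P (cond_cdf K)
      <= (C `^ (2 / (h + 1)) * M `^ (h / (h + 1)) * 8 `^ (h / (h + 1))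
            * (h `^ (- (h / (h + 1))) + h `^ (1 / (h + 1)))
            * n%:R `^ (- (h / (h + 1))))%:E)%E)
  /\
  ((2 <= d)%N -> forall n k : nat, (1 <= k <= n)%N ->
     k%:R = (M * d%:R / (2 * h * C ^+ 2 * c_ d `^ h))
                `^ (d%:R / (2 * h + d%:R))
              * n%:R `^ (2 * h / (2 * h + d%:R)) ->
     (knn_expected_risk P n k - risk P (cond_cdf K)
      <= ((C ^+ 2 * c_ d `^ h) `^ (d%:R / (2 * h + d%:R))
            * M `^ (2 * h / (2 * h + d%:R))
            * ((d%:R / (2 * h)) `^ (2 * h / (2 * h + d%:R))
               + (2 * h / d%:R) `^ (d%:R / (2 * h + d%:R)))
            * n%:R `^ (- (2 * h / (2 * h + d%:R))))%:E)%E).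
Proof.
move=> d0 h01 C0 M0 _ Pclass; have /andP[h0 _] := h01.
have P_cube : {ae P, forall u, unit_cube u.1} by case: Pclass => ? _ [].
split=> [d1|d2] n k kn kE; have n0 : (0 < n)%N by case/andP: kn => /leq_trans; apply.
  have nR : 0 < n%:R :> R by rewrite ltr0n.
  have h8 : 0 < 8 `^ h :> R by exact: powR_gt0.
  (* The optimisation is used with a = h and A = C^2 8 ^ h. *)
  have A0 : 0 < C ^+ 2 * 8 `^ h by rewrite mulr_gt0 ?exprn_gt0.
  have := knn_excess_risk_le K h0 C0 M0 Pclass kn
    (sample_radius_powR1 d0 P_cube kn h01 d1).
  rewrite mulrA (knn_optimal_bound h0 A0 M0 nR); last by rewrite mulrA.
  move=> /le_trans; apply; rewrite lee_fin le_eqVlt; apply/orP; left; apply/eqP.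
  congr (_ * _); rewrite [X in _ * X]addrC; congr (_ * _).
  rewrite powRM ?sqr_ge0 ?powR_ge0// -powRrM -powR_mulrn ?(ltW C0)// -powRrM.
  by rewrite !mulrA !mulr1 mulrAC.
have dR : 0 < d%:R :> R by rewrite ltr0n.
have nR : 0 < n%:R :> R by rewrite ltr0n.
have V_gt0 : 0 < unit_ball_volume d :> R.
  exact: unit_ball_volume_gt0.
have c0 : 0 < c_ d :> R.
  apply: divr_gt0; last exact: powR_gt0.
  apply: mulr_gt0; first exact: powR_gt0.
  by apply: exprn_gt0; rewrite ltr_pwDl// sqrtr_ge0.
have A0 : 0 < C ^+ 2 * c_ d `^ h by rewrite mulr_gt0 ?exprn_gt0 ?powR_gt0.
have a0 : 0 < 2 * h / d%:R by rewrite divr_gt0 ?mulr_gt0.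
(* With a = 2 h / d, the exponents of the statement are 1 / (a + 1) and a / (a + 1). *)
have e1 : d%:R / (2 * h + d%:R) = 1 / (2 * h / d%:R + 1).
  by field; rewrite !gt_eqF// ?addr_gt0 ?mulr_gt0.
have e2 : 2 * h / (2 * h + d%:R) = (2 * h / d%:R) / (2 * h / d%:R + 1).
  by field; rewrite !gt_eqF// ?addr_gt0 ?mulr_gt0.
have := knn_excess_risk_le K h0 C0 M0 Pclass kn
  (sample_radius_powR_ge2 d0 P_cube kn h01 d2).
rewrite mulrA (knn_optimal_bound a0 A0 M0 nR); last first.
  rewrite kE e1 e2; congr (_ `^ _ * _); field.
  by rewrite !gt_eqF// powR_gt0.
move=> /le_trans; apply; rewrite lee_fin e1 e2 le_eqVlt; apply/orP; left; apply/eqP.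
congr (_ * _); congr (_ * _); rewrite [RHS]addrC; congr (_ + _).
by rewrite -(invf_div (2 * h) d%:R) -(powR_inv1 (ltW a0)) -powRrM mulN1r.
Qed.
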